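(* Let $\mu,l,m\geq 1$, $s\geq 0$ and $1\leq\rho\leq\mu$ be integers with $\gcd(m,\mu+1)=1$. Let $$\lambda=\Lambda(\mu,s,l,\rho,m)=\left((m(s+l+1))^{\rho},(m(s+l))^{\mu},(m(s+l-1))^{\mu},\ldots,(m(s+1))^{\mu}\right),$$ $N=(s+l+1)\mu+s+\rho$ and $\kappa=-\frac{m}{\mu+1}$. Then the singular polynomial $\zeta_\lambda^x$ on $\mathbb{R}^N$ (specialized to this value of $\kappa$) is of isotype $\tau=\left(s(\mu+1)+\mu,\mu^l,\rho\right)$ (where $|\tau|=N$).
   Context: $\kappa$ is a formal parameter (transcendental over $\mathbb{Q}$); polynomials in $x=(x_1,\ldots,x_N)$ have coefficients in $\mathbb{Q}(\kappa)$. For $w\in S_N$, $(xw)_i=x_{w(i)}$ and $wf(x)=f(xw)$; $(i,j)$ denotes the transposition interchanging $x_i$ and $x_j$. Dunkl operators: $\mathcal{D}_i f(x)=\frac{\partial}{\partial x_i}f(x)+\kappa\sum_{j\neq i}\frac{f(x)-(i,j)f(x)}{x_i-x_j}$. Set $\mathcal{U}_i f=\mathcal{D}_i(x_i f)-\kappa\sum_{j=1}^{i-1}(j,i)f$, $1\leq i\leq N$. A nonzero polynomial $p$ is a singular polynomial for the singular value $\kappa_0$ if $\mathcal{D}_ip=0$ for all $1\leq i\leq N$ when $\kappa$ is specialized to $\kappa_0$. It is known that $\zeta_\lambda^x$ for the given $\lambda$ has no pole at $\kappa=-\frac{m}{\mu+1}$ and is a singular polynomial there. For $\alpha\in\mathbb{N}_0^N$,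 $|\alpha|=\sum\alpha_i$, $\alpha^+$ is the nonincreasing rearrangement of $\alpha$. $\alpha\succ\beta$ means $\alpha\neq\beta$ and $\sum_{i=1}^j\alpha_i\geq\sum_{i=1}^j\beta_i$ for $1\leq j\leq N$; $\alpha\vartriangleright\beta$ means $|\alpha|=|\beta|$ and either $\alpha^+\succ\beta^+$, or $\alpha^+=\beta^+$ and $\alpha\succ\beta$. $r(\alpha,i)=\#\{j:\alpha_j>\alpha_i\}+\#\{j:1\leq j\leq i,\alpha_j=\alpha_i\}$ and $\xi_i(\alpha)=(N-r(\alpha,i))\kappa+\alpha_i+1$. The $x$-monic nonsymmetric Jack polynomial $\zeta_\alpha^x$ is the unique polynomial $\zeta_\alpha^x=x^\alpha+\sum_{\alpha\vartriangleright\beta}A^x_{\beta\alpha}x^\beta$, $A^x_{\beta\alpha}\in\mathbb{Q}(\kappa)$, with $\mathcal{U}_i\zeta^x_\alpha=\xi_i(\alpha)\zeta^x_\alpha$ for $1\leq i\leq N$. The irreducible representations of $S_N$ are labeled by partitions of $N$ in the usual way ($(N)$ labels the trivial representation). A polynomial $f$ (here with rational coefficients, after specializing $\kappa$) is of isotype $\tau$ if $f$ is an element of an irreducible $S_N$-submodule of the space of homogeneous polynomials on which the representation $\tau$ is realized. Exponents in partitions denote multiplicities; partitions of length at most $N$ are viewed in $\mathbb{N}_0^N$ by appending zeros. *)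

(* Defs.v *)
From mathcomp Require Export all_boot all_order all_fingroup all_algebra.
From mathcomp Require Export mpoly.

Set Implicit Arguments.
Unset Strict Implicit.
Unset Printing Implicit Defensive.

Import GRing.Theory.
Local Open Scope ring_scope.

(* All indices are shifted: variables are numbered by 'I_N = {0, .., N-1}.
   [msym w f] substitutes 'X_(w i) for 'X_i, so it is f(xw) with
   (xw)_i = x_{w(i)}. *)

Section Operators.
Variables (K : fieldType) (N : nat) (k : K).
Implicit Types (f : {mpoly K[N]}) (i : 'I_N).

Notation tofracP := (@tofrac {mpoly K[N]}).

(* The divided differences are taken in the field of fractions K(x_1,..,x_N);
   their values are (images of) polynomials. *)
Definition dunkl i f : {fraction {mpoly K[N]}} :=
  tofracP (f^`M(i)) +
  tofracP k%:MP *
    \sum_(j < N | j != i) tofracP (f - msym (tperm i j) f) / tofracP ('X_i - 'X_j).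

Definition cherednik i f : {fraction {mpoly K[N]}} :=
  dunkl i ('X_i * f) -
  tofracP (k *: \sum_(j < N | (j < i)%N) msym (tperm j i) f).

Definition singular f : Prop := f != 0 /\ forall i, dunkl i f = 0.

End Operators.

Definition dominates (a b : seq nat) : bool :=
  (a != b) && [forall j : 'I_(size a), sumn (take j.+1 b) <= sumn (take j.+1 a)]%N.

Definition decr (a : seq nat) : seq nat := sort geq a.

Definition comp_gt N (a b : 'X_{1..N}) : bool :=
  (mdeg a == mdeg b) &&
  (dominates (decr a) (decr b) || (decr a == decr b) && dominates a b).

Definition rankc N (a : 'X_{1..N}) (i : 'I_N) : nat :=
  (#|[set j : 'I_N | a i < a j]| +
   #|[set j : 'I_N | (j <= i) && (a j == a i)]|)%N.

Definition Qkappa : fieldType := {fraction {poly rat}}.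
Definition kappa : Qkappa := tofrac 'X.

Definition spectral N (a : 'X_{1..N}) (i : 'I_N) : Qkappa :=
  (N%:R - (rankc a i)%:R) * kappa + (a i)%:R + 1.

Definition is_nsJack N (a : 'X_{1..N}) (z : {mpoly Qkappa[N]}) : Prop :=
  [/\ z@_a = 1,
      forall b, b != a -> z@_b != 0 -> comp_gt a b
    & forall i, cherednik kappa i z = tofrac (spectral a i *: z)].

(* The rational function c has no pole at k0, and takes the value v there. *)
Definition value_at (k0 : rat) (c : Qkappa) (v : rat) : Prop :=
  exists p q : {poly rat},
    [/\ q.[k0] != 0, c = tofrac p / tofrac q & v = p.[k0] / q.[k0]].

Definition specializes N (k0 : rat) (z : {mpoly Qkappa[N]})
    (p : {mpoly rat[N]}) : Prop :=
  forall b, value_at k0 z@_b p@_b.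

Section Isotype.
Variable N : nat.
Implicit Types (M : {mpoly rat[N]} -> Prop) (tau : seq nat) (f : {mpoly rat[N]}).

Definition submodule M : Prop :=
  [/\ M 0,
      forall (c : rat) u v, M u -> M v -> M (c *: u + v)
    & forall (w : 'S_N) u, M u -> M (msym w u)].

Definition irreducible M : Prop :=
  [/\ submodule M,
      exists2 u, M u & u != 0
    & forall M', submodule M' -> (forall u, M' u -> M u) ->
        (exists2 u, M' u & u != 0) -> forall u, M u -> M' u].

(* A linear map defined on a subspace extends to the whole space, so nothing is
   lost by asking that phi be defined on all polynomials. *)
Definition isomorphic M M' : Prop :=
  exists phi : {linear {mpoly rat[N]} -> {mpoly rat[N]}},
    [/\ forall (w : 'S_N) u, M u -> phi (msym w u) = msym w (phi u),
        forall u, M u -> phi u = 0 -> u = 0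
      & forall v, M' v <-> exists2 u, M u & phi u = v].

(* The N cells of the Young diagram of tau |- N are numbered row by row, cell k
   being in row [reshape_index tau k] and column [reshape_offset tau k]; the
   tableau t has the entry t k in cell k.  Its Specht polynomial is the product
   over the columns of the differences x_a - x_b, with a above b. *)
Definition specht_poly tau (t : 'S_N) : {mpoly rat[N]} :=
  \prod_(k < N) \prod_(k' < N | (reshape_offset tau k == reshape_offset tau k') &&
                  (reshape_index tau k < reshape_index tau k')%N)
     ('X_(t k) - 'X_(t k')).

(* Specht's realization of the irreducible representation labeled by tau;
   tau = [:: N] gives the constants, that is the trivial representation. *)
Definition specht tau f : Prop :=
  exists c : 'S_N -> rat, f = \sum_(t : 'S_N) c t *: specht_poly tau t.

Definition of_isotype tau f : Prop :=
  exists (d : nat) (M : {mpoly rat[N]} -> Prop),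
    [/\ forall u, M u -> u \is d.-homog, irreducible M,
        isomorphic M (specht tau) & M f].

End Isotype.

Definition Lambda (mu s l rho m : nat) : seq nat :=
  nseq rho (m * (s + l + 1))%N ++
  flatten [seq nseq mu (m * (s + l - j))%N | j <- iota 0 l].

Definition Tau (mu s l rho : nat) : seq nat :=
  (s * mu.+1 + mu)%N :: rcons (nseq l mu) rho.

(* A partition of length at most N, padded with zeros. *)
Definition pad N (a : seq nat) : 'X_{1..N} := [multinom nth 0%N a i | i < N].

(* Main.v *)
(* Since the Dunkl operators kill p, the Cherednik operator U_i acts on it as
   1 + k0 w_i, where w_i = sum_(j > i) (i j) is a Jucys-Murphy element.  So the
   specialized spectral vector of zeta_lambda makes p an eigenvector of all the w_i,
   with eigenvalues the contents of the tableau of shape tau whose cells are filled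
   row by row with the positions N, N-1, .., 1.

   Positivity of the invariant inner product then shows that p is fixed by the row
   group, and that for each position i and each row r above that of i,
   p + sum_(q in row r) (q i) p = 0.  These relations determine the function
   w |-> <p, w p> up to a factor: if w sends i into row r while preserving the rows
   above r, the relation rewrites <p, w p> by means of permutations that send more
   elements of row r to row r.  Hence p generates an irreducible module, isomorphic to
   the one generated by any other nonzero vector with the same properties.  The
   orthogonal projection to the Specht module of the monomial prod_i x_i^(row of i) is
   such a vector, and it generates the Specht module. *)

From HB Require Import structures.
Require Import Defs.
From mathcomp Require Import ring zify.

Set Implicit Arguments.
Unset Strict Implicit.
Unset Printing Implicit Defensive.

Import Order.TTheory GRing.Theory Num.Theory.
Local Open Scope ring_scope.

(* [msym] is defined by a big sum, which unification would otherwise expose when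
   rewriting with lemmas on sums. *)
Opaque msym.

Lemma msym_Xvar (R : comNzRingType) N (w : 'S_N) (i : 'I_N) :
  msym w 'X_i = 'X_(w i) :> {mpoly R[N]}.
Proof.
rewrite msymX; congr 'X_[_]; apply/mnmP => j; rewrite mnmE !mnm1E.
by rewrite -(inj_eq (@perm_inj _ w)) permKV.
Qed.

(** * The invariant inner product and orthogonal projection *)

Section InnerProduct.
Variable N : nat.
Implicit Types (u v f g : {mpoly rat[N]}) (w : 'S_N).

Definition dot u v : rat := \sum_(m <- msupp u) u@_m * v@_m.

Lemma dot_is_scalar u : scalar (dot u).
Proof.
move=> c v v'; rewrite /dot mulr_sumr -big_split /=; apply: eq_bigr => m _.
by rewrite mcoeffD mcoeffZ; ring.
Qed.

HB.instance Definition _ u :=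
  GRing.isLinear.Build rat {mpoly rat[N]} rat *%R (dot u) (dot_is_scalar u).

(** Frees the sum from the support of [u], which enters [dot] asymmetrically; symmetry and
    invariance rest on this. *)
Lemma dotE (s : seq 'X_{1..N}) u v : uniq s -> {subset msupp u <= s} ->
  dot u v = \sum_(m <- s) u@_m * v@_m.
Proof.
move=> us sub; rewrite (bigID (mem (msupp u))) /= [X in _ + X]big1 ?addr0.
  rewrite -big_filter; apply: perm_big; apply: uniq_perm.
  - exact: msupp_uniq.
  - exact: filter_uniq.
  - by move=> m; rewrite mem_filter andb_idr // => /sub.
by move=> m; rewrite mcoeff_msupp negbK => /eqP ->; rewrite mul0r.
Qed.

Lemma dotC u v : dot u v = dot v u.
Proof.
pose s := undup (msupp u ++ msupp v).
have us : uniq s by exact: undup_uniq.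
rewrite (@dotE s u) ?(@dotE s v) //; first by apply: eq_bigr => m _; exact: mulrC.
  by move=> m; rewrite mem_undup mem_cat orbC => ->.
by move=> m; rewrite mem_undup mem_cat => ->.
Qed.

Lemma dot_suml I (r : seq I) (P : pred I) (F : I -> {mpoly rat[N]}) v :
  dot (\sum_(i <- r | P i) F i) v = \sum_(i <- r | P i) dot (F i) v.
Proof. by rewrite dotC linear_sum; apply: eq_bigr => i _; exact: dotC. Qed.

Lemma dot_sumr I (r : seq I) (P : pred I) (F : I -> {mpoly rat[N]}) v :
  dot v (\sum_(i <- r | P i) F i) = \sum_(i <- r | P i) dot v (F i).
Proof. exact: (linear_sum (dot v)). Qed.

Lemma msym_sum (w : 'S_N) I (r : seq I) (P : pred I) (F : I -> {mpoly rat[N]}) :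
  msym w (\sum_(i <- r | P i) F i) = \sum_(i <- r | P i) msym w (F i).
Proof. exact: (linear_sum (msym w)). Qed.

Lemma dotZl c u v : dot (c *: u) v = c * dot u v.
Proof. by rewrite dotC linearZ /= dotC. Qed.

Lemma dotZr c u v : dot u (c *: v) = c * dot u v.
Proof. by rewrite linearZ. Qed.

Lemma dotDr u v v' : dot u (v + v') = dot u v + dot u v'.
Proof. exact: (linearD (dot u)). Qed.

Lemma dotBr u v v' : dot u (v - v') = dot u v - dot u v'.
Proof. exact: (linearB (dot u)). Qed.

Lemma dotDl u u' v : dot (u + u') v = dot u v + dot u' v.
Proof. by rewrite dotC linearD /= !(dotC v). Qed.

Lemma dotBl u u' v : dot (u - u') v = dot u v - dot u' v.
Proof. by rewrite dotC linearB /= !(dotC v). Qed.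

Lemma dot0l v : dot 0 v = 0.
Proof. by rewrite dotC linear0. Qed.

Lemma dot_ge0 u : 0 <= dot u u.
Proof. by apply: sumr_ge0 => m _; rewrite -expr2 sqr_ge0. Qed.

Lemma dot_eq0 u : (dot u u == 0) = (u == 0).
Proof.
apply/idP/eqP => [|->]; last by rewrite dot0l.
rewrite psumr_eq0 => [/allP h|m _]; last by rewrite -expr2 sqr_ge0.
apply: msuppnil0; case e: (msupp u) => [//|m r].
have mu : m \in msupp u by rewrite e mem_head.
by have := h m mu; rewrite mulf_eq0 orbb mcoeff_eq0 mu.
Qed.

(** The monomials are orthonormal for [dot], and a permutation of the variables permutes them. *)
Lemma dot_msym w u v : dot (msym w u) (msym w v) = dot u v.
Proof.
pose h (m : 'X_{1..N}) := [multinom m ((w^-1)%g i) | i < N].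
have hK (m : 'X_{1..N}) : [multinom h m (w i) | i < N] = m.
  by apply/mnmP => i; rewrite !mnmE permK.
have hK' (m : 'X_{1..N}) : h [multinom m (w i) | i < N] = m.
  by apply/mnmP => i; rewrite !mnmE permKV.
rewrite (@dotE (map h (msupp u))).
- by rewrite big_map; apply: eq_bigr => m _; rewrite !mcoeff_sym hK.
- rewrite map_inj_uniq ?msupp_uniq //.
  by apply: (can_inj (g := fun m : 'X_{1..N} => [multinom m (w i) | i < N])).
- move=> m; rewrite mcoeff_msupp mcoeff_sym -mcoeff_msupp => mu.
  by rewrite -(hK' m); apply: map_f.
Qed.

Lemma dot_msymr w u v : dot u (msym w v) = dot (msym w^-1 u) v.
Proof. by rewrite -(dot_msym w (msym _ u)) -msymMm mulVg msym1m. Qed.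

Lemma msym_tpermK (i j : 'I_N) u : msym (tperm i j) (msym (tperm i j) u) = u.
Proof. by rewrite -msymMm tperm2 msym1m. Qed.

Lemma dot_tperm (i j : 'I_N) u v :
  dot u (msym (tperm i j) v) = dot (msym (tperm i j) u) v.
Proof. by rewrite dot_msymr tpermV. Qed.

Lemma dot_sum_eq0 I (r : seq I) (c : I -> rat) (e : I -> {mpoly rat[N]}) v :
  (forall i, c i = 0 \/ dot v (e i) = 0) -> dot v (\sum_(i <- r) c i *: e i) = 0.
Proof.
move=> h; rewrite linear_sum big1 // => i _; rewrite linearZ /=.
by case: (h i) => ->; rewrite ?mul0r ?mulr0.
Qed.

(** Gram-Schmidt for a family that may be linearly dependent; [r] lists the vectors already
    treated. *)
Lemma orthogonal_projection (T : finType) (e : T -> {mpoly rat[N]}) u :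
  exists c : T -> rat, forall t, dot (u - \sum_t' c t' *: e t') (e t) = 0.
Proof.
suff H (r : seq T) : forall u, exists c : T -> rat,
    (forall t, t \notin r -> c t = 0) /\
    (forall t, t \in r -> dot (u - \sum_t' c t' *: e t') (e t) = 0).
  have [c [_ h]] := H (enum T) u.
  by exists c => t; apply: h; rewrite mem_enum.
elim: r {u} => [|t0 r IH] u; first by exists (fun=> 0).
have [c [c0 hc]] := IH u; have [d [d0 hd]] := IH (e t0).
set g := \sum_t' c t' *: e t' in hc; set g0 := \sum_t' d t' *: e t' in hd.
set x := e t0 - g0 in hd.
have orth v : (forall t, t \in r -> dot v (e t) = 0) -> dot v g0 = 0.
  move=> hv; apply: dot_sum_eq0 => t.
  by case: (boolP (t \in r)) => [/hv|/d0]; [right|left].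
have et0 : e t0 = x + g0 by rewrite subrK.
(* [x] is the part of [e t0] orthogonal to the vectors of [r]. If it vanishes, [e t0] lies in their
   span and the old coefficients still serve; otherwise a multiple of [x] corrects the
   projection. *)
have [x0|xn0] := eqVneq x 0.
  exists c; split=> [t|t]; first by rewrite inE negb_or => /andP[_ /c0].
  rewrite inE => /orP[/eqP ->|/hc //]; rewrite et0 x0 add0r; exact: orth.
pose a := dot (u - g) (e t0) / dot x x.
exists (fun t => c t + a * ((t == t0)%:R - d t)); split=> [t|t].
  rewrite inE negb_or => /andP[/negPf -> nr].
  by rewrite c0 // d0 // subr0 mulr0 addr0.
have -> : \sum_t' (c t' + a * ((t' == t0)%:R - d t')) *: e t' = g + a *: x.
  rewrite (eq_bigr (fun t' => c t' *: e t' +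
      a *: ((t' == t0)%:R *: e t' - d t' *: e t'))); last first.
    by move=> t' _; rewrite scalerDl -scalerA scalerBl.
  rewrite big_split /= -scaler_sumr sumrB; congr (_ + a *: (_ - _)).
  rewrite (bigD1 t0) //= eqxx scale1r big1 ?addr0 // => t' /negPf ->.
  by rewrite scale0r.
rewrite opprD addrA dotBl dotZl inE => /orP[/eqP ->|tr]; last first.
  by rewrite hc // hd // mulr0 subr0.
have -> : dot x (e t0) = dot x x by rewrite et0 linearD /= (orth x hd) addr0.
by rewrite /a divfK ?subrr // dot_eq0.
Qed.

End InnerProduct.

(** * Group algebra action and cyclic submodules *)

Section Cyclic.
Variable N : nat.
Implicit Types (u v f g : {mpoly rat[N]}) (w : 'S_N) (x y : 'S_N -> rat).

(** The function [x] stands for the element of the group algebra with coefficients [x w]. *)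
Definition act x f : {mpoly rat[N]} := \sum_w x w *: msym w f.

Definition cyclic_span f v : Prop := exists x, v = act x f.

Lemma act_is_linear x : linear (act x).
Proof.
move=> c u v; rewrite /act scaler_sumr -big_split /=; apply: eq_bigr => w _.
by rewrite linearP scalerDr !scalerA mulrC.
Qed.

HB.instance Definition _ x :=
  GRing.isLinear.Build rat {mpoly rat[N]} {mpoly rat[N]} _ (act x) (act_is_linear x).

Lemma cyclic_span_submodule f : submodule (cyclic_span f).
Proof.
split.
- by exists (fun=> 0); rewrite /act big1 // => w _; rewrite scale0r.
- move=> c u v [x ->] [y ->]; exists (fun w => c * x w + y w).
  rewrite /act scaler_sumr -big_split /=; apply: eq_bigr => w _.
  by rewrite scalerDl scalerA.
- move=> w u [x ->]; exists (fun w' => x (w' * w^-1)%g).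
  rewrite /act linear_sum [RHS](reindex_inj (mulIg w)) /=; apply: eq_bigr => w' _.
  by rewrite linearZ /= mulgK msymMm.
Qed.

Lemma cyclic_span_id f : cyclic_span f f.
Proof.
exists (fun w => (w == 1%g)%:R); rewrite /act (bigD1 1%g) //= eqxx scale1r msym1m.
by rewrite big1 ?addr0 // => w /negPf ->; rewrite scale0r.
Qed.

Lemma submodule_sum (M : {mpoly rat[N]} -> Prop) I (r : seq I) (P : pred I)
    (F : I -> {mpoly rat[N]}) :
  submodule M -> (forall i, P i -> M (F i)) -> M (\sum_(i <- r | P i) F i).
Proof.
case=> M0 MD _ h; elim/big_ind: _ => // u v Mu Mv.
by rewrite -[u]scale1r; apply: MD.
Qed.

Lemma submoduleZ (M : {mpoly rat[N]} -> Prop) c u : submodule M -> M u -> M (c *: u).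
Proof. by case=> M0 MD _ Mu; rewrite -[_ *: _]addr0; apply: MD. Qed.

Lemma submoduleB (M : {mpoly rat[N]} -> Prop) u v :
  submodule M -> M u -> M v -> M (u - v).
Proof.
by case=> M0 MD _ Mu Mv; rewrite addrC -scaleN1r; apply: MD.
Qed.

Lemma submodule_act (M : {mpoly rat[N]} -> Prop) x f :
  submodule M -> M f -> M (act x f).
Proof.
move=> sM Mf; apply: submodule_sum => // w _; apply: submoduleZ => //.
by case: sM => _ _; apply.
Qed.

Lemma cyclic_span_sub f v M : submodule M -> M f -> cyclic_span f v -> M v.
Proof. by move=> sM Mf [x ->]; apply: submodule_act. Qed.

Lemma cyclic_span_decomp f u : exists2 f',
  cyclic_span u f' & forall v, cyclic_span u v -> dot (f - f') v = 0.
Proof.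
have [c h] := orthogonal_projection (fun w => msym w u) f.
exists (act c u); first by exists c.
by move=> v [y ->]; apply: dot_sum_eq0 => w; right; apply: h.
Qed.

(** By invariance of [dot], the orthogonal complement of a submodule is a submodule. *)
Lemma cyclic_span_act_orthogonal u f x :
  (forall v, cyclic_span u v -> dot f v = 0) ->
  (forall v, cyclic_span u v -> dot (act x f) v = 0).
Proof.
move=> h v uv; rewrite dotC; apply: dot_sum_eq0 => w; right.
rewrite dot_msymr dotC; apply: h.
by case: (cyclic_span_submodule u) => _ _; apply.
Qed.

(** [act x f'] lies in the span of [u] and [act x (f - f')] in its orthogonal complement; as they
    add up to zero, both vanish. *)
Lemma cyclic_span_act_eq0 f f' u x :
  cyclic_span u f' -> (forall v, cyclic_span u v -> dot (f - f') v = 0) ->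
  act x f = 0 -> act x f' = 0 /\ act x (f - f') = 0.
Proof.
move=> uf' h xf0; have sM := cyclic_span_submodule u.
have uxf' := submodule_act x sM uf'.
have e : act x f' = (- 1) *: act x (f - f').
  by rewrite linearB /= xf0 sub0r scaleN1r opprK.
have : act x f' == 0.
  by rewrite -dot_eq0 {1}e dotZl (cyclic_span_act_orthogonal x h) // mulr0.
by move/eqP => xf'0; rewrite linearB /= xf'0 xf0 subrr.
Qed.

End Cyclic.

(** * Vectors satisfying the row relations of a tableau *)

Section RowVectors.
Variables (N : nat) (rw : 'I_N -> nat).
Implicit Types (u v f g : {mpoly rat[N]}) (w : 'S_N) (x : 'S_N -> rat).

(** For [i] outside row [r], the identity and the [tperm q i] represent the cosets of the symmetric
    group of row [r] in that of row [r] enlarged by [i]. On a row-invariant [f] this is, up to a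
    factor, the symmetrization over the enlarged row. *)
Definition row_sum i r f : {mpoly rat[N]} :=
  f + \sum_(q | rw q == r) msym (tperm q i) f.

Definition row_invariant f : Prop :=
  forall i j, rw i = rw j -> msym (tperm i j) f = f.

Definition row_vector f : Prop :=
  row_invariant f /\ forall i r, (r < rw i)%N -> row_sum i r f = 0.

Section Spherical.
Variable D : 'S_N -> rat.
Hypothesis Dr : forall i j w, rw i = rw j -> D (w * tperm i j)%g = D w.
Hypothesis Drow : forall i r w, (r < rw i)%N ->
  D w + \sum_(q | rw q == r) D (tperm q i * w)%g = 0.
Hypothesis D1 : D 1%g = 0.

(** Composing with [tperm (w a) a] makes [a] a fixed point and leaves [D] unchanged, since [w a] and
    [a] share a row. This reduces [w] to the identity. *)
Lemma spherical_young w : (forall i, rw (w i) = rw i) -> D w = 0.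
Proof.
have [n] := ubnP #|[set i | w i != i]|; elim: n w => // n IH w.
rewrite ltnS => hn hw.
have [/existsP[a wa]|] := boolP [exists a, w a != a]; last first.
  rewrite negb_exists => /forallP h; have -> : w = 1%g; last exact: D1.
  by apply/permP => i; rewrite perm1; apply/eqP; have := h i; rewrite negbK.
rewrite -(@Dr (w a) a) ?hw //; apply: IH; last first.
  move=> i; rewrite permM; case: tpermP => [e|e|_ _]; rewrite ?hw //.
    by rewrite -[RHS]hw e hw.
  by rewrite -[RHS]hw e.
apply: leq_trans hn; apply: proper_card; apply/properP; split.
  apply/subsetP => i; rewrite !inE permM; apply: contraNneq => wi.
  rewrite wi tpermD // ?eq_refl //; last by apply: contraNneq wa => ->; rewrite wi.
  by apply: contraNneq wa => e; apply/eqP; apply: (@perm_inj _ w); rewrite e wi.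
by exists a; rewrite !inE // permM tpermL eqxx.
Qed.

(* If [w] preserves the rows above [r] but not row [r], it sends some [i] of a lower
   row into row [r].  In the relation [Drow] for [i], [r] and [w], the [q] that [w]
   sends to row [r] contribute [D w], and the other permutations [tperm q i * w] send
   one more element of row [r] to row [r]. *)
Lemma spherical_eq0 w : D w = 0.
Proof.
pose P r := forall w, (forall i, (rw i < r)%N -> rw (w i) = rw i) -> D w = 0.
suff H r : P r by apply: (H 0%N).
(* Descending induction on [r]: from [B] on, every row is preserved and [spherical_young]
   applies. *)
pose B := \max_i (rw i).+1.
have [k] := ubnP (B - r); elim: k r => // k IHk r; rewrite ltnS => hk {}w hw.
have [Br|rB] := leqP B r.
  apply: spherical_young => i; apply: hw; apply: leq_trans Br.
  exact: (leq_bigmax i).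
have {IHk} Pr1 : P r.+1 by apply: IHk; lia.
pose def w := [set i | (rw i == r) && (rw ((w : 'S_N) i) != r)].
have [n] := ubnP #|def w|; elim: n w hw => // n IH w hw; rewrite ltnS => hn.
have [/pred0P d0|] := boolP (pred0b (mem (def w))).
  apply: Pr1 => i; rewrite ltnS leq_eqVlt => /orP[/eqP ri|]; last exact: hw.
  by have := d0 i; rewrite /= inE ri eqxx /= => /negbFE /eqP.
case/pred0Pn => a; rewrite !inE => /andP[/eqP ra rwa].
(* Otherwise the preimage of row [r] under [w] would be contained in row [r], hence equal to it by
   cardinality, against the choice of [a]. *)
have [i ri wi] : exists2 i, rw i != r & rw (w i) = r.
  have [/existsP[i /andP[ri /eqP wi]]|no] := boolP
      [exists i, (rw i != r) && (rw (w i) == r)].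
    by exists i.
  pose A := [set i | rw i == r].
  have sub : w @^-1: A \subset A.
    apply/subsetP => j; rewrite !inE => wj; apply: contraNT no => rj.
    by apply/existsP; exists j; rewrite rj.
  have /setP/(_ a) : w @^-1: A = A.
    by apply/eqP; rewrite eqEcard sub card_preimset ?leqnn //; exact: perm_inj.
  by rewrite !inE ra eqxx (negPf rwa).
have ri' : (r < rw i)%N.
  by rewrite ltn_neqAle eq_sym ri leqNgt; apply: contraNN ri => /hw <-; apply/eqP.
have := Drow w ri'.
rewrite (bigID (fun q => rw (w q) == r)) /= [X in _ + (_ + X)]big1; last first.
  move=> q /andP[/eqP rq rwq]; apply: IH => [j rj|].
    rewrite permM tpermD ?hw //; apply: contraTneq rj => <-; lia.
  apply: leq_trans hn; apply: proper_card; apply/properP; split.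
    apply/subsetP => j; rewrite !inE permM => /andP[/eqP rj].
    rewrite rj eqxx /=; case: tpermP => [_|e|//]; first by rewrite wi eqxx.
    by rewrite -e rj eqxx in ri.
  by exists q; rewrite !inE ?rq ?eqxx //= permM tpermL wi eqxx.
rewrite (eq_bigr (fun=> D w)) => [|q /andP[/eqP rq /eqP rwq]]; last first.
  have -> : (tperm q i * w = w * tperm (w q) (w i))%g.
    by rewrite -tpermJ conjgE !mulgA mulgV mul1g.
  by rewrite Dr // rwq wi.
by rewrite sumr_const addr0 -mulrS => /eqP; rewrite mulrn_eq0 /= => /eqP.
Qed.

End Spherical.

(** Both sides, as functions of [w], satisfy the linear conditions on [D] and agree at the identity,
    so [spherical_eq0] applies to their difference. *)
Lemma row_vector_matrix_coeff f g w : row_vector f -> row_vector g ->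
  dot f (msym w f) * dot g g = dot g (msym w g) * dot f f.
Proof.
move=> [fR f0] [gR g0]; apply/eqP; rewrite -subr_eq0; apply/eqP.
apply: (@spherical_eq0 (fun w =>
  dot f (msym w f) * dot g g - dot g (msym w g) * dot f f)).
- by move=> i j w' h; rewrite !msymMm (dot_tperm i j f) (dot_tperm i j g) fR // gR.
- move=> i r w' h; rewrite sumrB -!mulr_suml addrACA -!mulrDl -opprD -!mulrDl.
  have E u : row_sum i r u = 0 -> dot u (msym w' u) +
      \sum_(q | rw q == r) dot u (msym (tperm q i * w') u) = 0.
    move=> e; have : dot u (msym w' (row_sum i r u)) = 0 by rewrite e !linear0.
    rewrite /row_sum msymD msym_sum (linearD (dot u)) /=.
    rewrite [dot u (\sum_(_ | _) _)]dot_sumr => h0.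
    apply: etrans h0; congr (_ + _).
        by apply: eq_bigr => q _; rewrite msymMm.
  by rewrite !E ?f0 ?g0 // !mul0r subrr.
- by rewrite !msym1m mulrC subrr.
Qed.

(** The squared norm of [act x f] is a quadratic form in [x] whose coefficients are values
    [dot f (msym w f)], so the forms of [f] and [g] are proportional. Hence all nonzero row vectors
    have the same annihilator. *)
Lemma row_vector_act_eq0 f g x : row_vector f -> row_vector g -> f != 0 ->
  act x f = 0 -> act x g = 0.
Proof.
move=> fv gv fn0 xf; apply/eqP; rewrite -dot_eq0.
have E u : dot (act x u) (act x u) =
    \sum_w \sum_w' x w * x w' * dot u (msym (w' * w^-1)%g u).
  rewrite /act dot_suml; apply: eq_bigr => w _; rewrite dot_sumr.
  apply: eq_bigr => w' _; rewrite dotZl linearZ /= -mulrA.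
  by rewrite -(dot_msym w^-1 (msym w u)) -!msymMm mulgV msym1m.
have : dot (act x f) (act x f) * dot g g = dot (act x g) (act x g) * dot f f.
  rewrite !E !mulr_suml; apply: eq_bigr => w _; rewrite !mulr_suml.
  apply: eq_bigr => w' _; rewrite -!mulrA; congr (_ * (_ * _)).
  exact: row_vector_matrix_coeff.
rewrite xf dot0l mul0r => /esym/eqP; rewrite mulf_eq0 dot_eq0.
by rewrite (negPf (_ : dot f f != 0)) ?orbF // dot_eq0.
Qed.

(** Writing the relations of a row vector as group algebra elements independent of [f] makes the
    property pass to any vector with a larger annihilator. *)
Lemma row_sum_act i r : exists x, forall f, row_sum i r f = act x f.
Proof.
exists (fun w => (w == 1%g)%:R + \sum_(q | rw q == r) (w == tperm q i)%:R) => f.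
have D1 w0 : \sum_w (w == w0)%:R *: msym w f = msym w0 f.
  rewrite (bigD1 w0) //= eqxx scale1r big1 ?addr0 // => w /negPf ->.
  exact: scale0r.
rewrite /act; under eq_bigr => w _ do rewrite scalerDl scaler_suml.
rewrite big_split /= D1 msym1m exchange_big /=; congr (_ + _).
by apply: eq_bigr => q _; rewrite D1.
Qed.

Lemma row_invariant_act i j : exists x, forall f, f - msym (tperm i j) f = act x f.
Proof.
exists (fun w => (w == 1%g)%:R - (w == tperm i j)%:R) => f.
have D1 w0 : \sum_w (w == w0)%:R *: msym w f = msym w0 f.
  rewrite (bigD1 w0) //= eqxx scale1r big1 ?addr0 // => w /negPf ->.
  exact: scale0r.
rewrite /act; under eq_bigr => w _ do rewrite scalerBl.
by rewrite sumrB !D1 msym1m.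
Qed.

Lemma row_vector_sub_annihilator f g :
  row_vector f -> (forall x, act x f = 0 -> act x g = 0) -> row_vector g.
Proof.
case=> fR f0 h; split=> [i j rij|i r ri].
  have [x hx] := row_invariant_act i j; apply/esym/eqP; rewrite -subr_eq0 hx.
  by apply/eqP/h; rewrite -hx fR // subrr.
by have [x hx] := row_sum_act i r; rewrite hx; apply: h; rewrite -hx f0.
Qed.

(** Let [f'] be the projection of [f] to the span of a nonzero [u] in the submodule. Both [f'] and
    [f - f'] are row vectors. Were both nonzero, they would have the same annihilator; but the [x]
    with [f' = act x f] kills [f - f'] and fixes [f']. So [f = f']. *)
Lemma row_vector_irreducible f :
  row_vector f -> f != 0 -> irreducible (cyclic_span f).
Proof.
move=> fv fn0; have sM := cyclic_span_submodule f.
split=> //; first by exists f => //; exact: cyclic_span_id.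
move=> M sM' sub [u Mu un0].
suff Mf : M f by move=> v; apply: cyclic_span_sub.
have [f' uf' orth] := cyclic_span_decomp f u.
have dec x := @cyclic_span_act_eq0 _ f f' u x uf' orth.
have fv' : row_vector f' by apply: row_vector_sub_annihilator fv _ => x /dec[].
have fv'' : row_vector (f - f') by apply: row_vector_sub_annihilator fv _ => x /dec[].
(* If [f] were orthogonal to the span of [u], so would be [u] itself, which lies in the span of
   [f]. *)
have f'n0 : f' != 0.
  apply: contraNneq un0 => f'0; rewrite f'0 in orth.
  have [x ux] := sub _ Mu; rewrite -dot_eq0 {1}ux; apply/eqP.
  apply: (@cyclic_span_act_orthogonal _ u); last exact: cyclic_span_id.
  by move=> v uv; rewrite -[f]subr0 orth.
have Mf' : M f' by exact: cyclic_span_sub uf'.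
have [x f'x] := sub _ Mf'.
have x0 : act x (f - f') = 0.
  apply/eqP; rewrite -dot_eq0.
  have sU := cyclic_span_submodule u.
  have xU : cyclic_span u (act x (f - f')).
    rewrite linearB /= -f'x; apply: submoduleB => //.
    exact: submodule_act.
  by rewrite (@cyclic_span_act_orthogonal _ u).
have [f''0|f''n0] := eqVneq (f - f') 0.
  by rewrite -[f](subrK f') f''0 add0r.
have xf' := row_vector_act_eq0 fv'' fv' f''n0 x0.
move: x0 f'n0; rewrite linearB /= xf' subr0 -f'x => ->.
by rewrite eqxx.
Qed.

(** The rank one map [u |-> dot f u *: g], summed over its conjugates by the group, which makes it
    equivariant. *)
Definition transfer f g u : {mpoly rat[N]} := \sum_w dot (msym w f) u *: msym w g.

Lemma transfer_is_linear f g : linear (transfer f g).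
Proof.
move=> c u v; rewrite /transfer scaler_sumr -big_split /=; apply: eq_bigr => w _.
by rewrite linearP /= scalerDl scalerA.
Qed.

HB.instance Definition _ f g := GRing.isLinear.Build rat {mpoly rat[N]}
  {mpoly rat[N]} _ (transfer f g) (transfer_is_linear f g).

Lemma transfer_msym f g w u : transfer f g (msym w u) = msym w (transfer f g u).
Proof.
rewrite /transfer linear_sum /= [LHS](reindex_inj (mulIg w)) /=.
by apply: eq_bigr => w' _; rewrite linearZ /= !msymMm dot_msym.
Qed.

Lemma transfer_act f g x u : transfer f g (act x u) = act x (transfer f g u).
Proof.
rewrite /act linear_sum; apply: eq_bigr => w _.
by rewrite linearZ /= transfer_msym.
Qed.

(** [transfer f g] sends [f] to a row vector [h] in the span of [g]. It is injective because [f] and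
    [h] have the same annihilator, and onto because [h] generates the irreducible span of [g]. *)
Lemma row_vector_isomorphic f g : row_vector f -> row_vector g ->
  f != 0 -> g != 0 -> isomorphic (cyclic_span f) (cyclic_span g).
Proof.
move=> fv gv fn0 gn0; pose h := transfer f g f.
have sg := cyclic_span_submodule g.
have gh : cyclic_span g h.
  apply: submodule_sum => // w _; apply: submoduleZ => //.
  by case: sg => _ _; apply; apply: cyclic_span_id.
have hv : row_vector h.
  apply: row_vector_sub_annihilator fv _ => x xf.
  by rewrite -transfer_act xf linear0.
have ffn0 : dot f f != 0 by rewrite dot_eq0.
(* [dot h g * dot f f] is a sum of squares times [dot g g], and the square at the identity is
   positive. *)
have hn0 : h != 0.
  apply/eqP => h0; have : dot h g * dot f f = 0 by rewrite h0 dot0l mul0r.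
  rewrite /h /transfer dot_suml mulr_suml.
  rewrite (eq_bigr (fun w => dot f (msym w f) ^+ 2 * dot g g)) => [/eqP|w _]; last first.
    rewrite dotZl -mulrA [dot (msym w g) g]dotC -row_vector_matrix_coeff //.
    by rewrite [dot (msym w f) f]dotC mulrA -expr2.
  rewrite -mulr_suml mulf_eq0 dot_eq0 (negPf gn0) orbF psumr_eq0; last first.
    by move=> w _; exact: sqr_ge0.
  move/allP/(_ 1%g); rewrite mem_index_enum => /(_ isT).
  by rewrite /= msym1m sqrf_eq0 (negPf ffn0).
exists (transfer f g); split.
- by move=> w u _; exact: transfer_msym.
- move=> u [x ->]; rewrite /= transfer_act => xh.
  exact: row_vector_act_eq0 hv fv hn0 xh.
- have [_ _ irr] := row_vector_irreducible gv gn0.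
  move=> v; split=> [gv'|[u [x ->] <-]].
    have [||x ->] := irr _ (cyclic_span_submodule h) _ _ v gv'.
    - by move=> u; apply: cyclic_span_sub.
    - by exists h => //; apply: cyclic_span_id.
    - by exists (act x f); [exists x | rewrite /= transfer_act].
  by rewrite /= transfer_act; apply: submodule_act.
Qed.

End RowVectors.

(** * Jucys-Murphy elements and their eigenvectors *)

Section JucysMurphy.
Variables (N : nat) (rw : 'I_N -> nat).
Implicit Types (f : {mpoly rat[N]}) (i j q : 'I_N).
Hypothesis rw_decr : forall i j, (i <= j)%N -> (rw j <= rw i)%N.

Definition jucys_murphy i f : {mpoly rat[N]} :=
  \sum_(j : 'I_N | (i < j)%N) msym (tperm i j) f.

(** The tableau is filled row by row from the last position on, so the later positions in the row of
    [i] are those to its left, and the first term is the column of [i]. *)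
Definition content i : rat :=
  #|[set q : 'I_N | (i < q)%N & rw q == rw i]|%:R - (rw i)%:R.

Lemma content_succ i i' : i' = i.+1 :> nat -> rw i = rw i' ->
  content i = content i' + 1.
Proof.
move=> ii' ri; rewrite /content (cardsD1 i') inE ii' leqnn ri eqxx natrD /=.
suff -> : [set q : 'I_N | (i < q)%N & rw q == rw i'] :\ i' =
    [set q : 'I_N | (i' < q)%N & rw q == rw i'] by rewrite -ii' -addrA addrC.
by apply/setP => q; rewrite !inE -val_eqE /=; lia.
Qed.

Lemma dot_jucys_murphy i f g : dot (jucys_murphy i f) g = dot f (jucys_murphy i g).
Proof.
rewrite dot_suml dot_sumr; apply: eq_bigr => j _; exact/esym/dot_tperm.
Qed.

(** Conjugating [jucys_murphy i'] by [tperm i i'] gives [jucys_murphy i] without the term of [i'];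
    this is the degenerate Hecke relation. *)
Lemma jucys_murphy_succ i i' f : i' = i.+1 :> nat ->
  jucys_murphy i (msym (tperm i i') f) = msym (tperm i i') (jucys_murphy i' f) + f.
Proof.
move=> ii'; rewrite /jucys_murphy (bigD1 i') /= ?ii' // msym_tpermK addrC.
rewrite msym_sum; congr (_ + _); apply: eq_big => [j|j /andP[ij ji']].
  by rewrite -val_eqE /=; lia.
rewrite -!msymMm; congr (msym _ f).
have -> : tperm i j = (tperm i' j ^ tperm i i')%g.
  rewrite tpermJ tpermR tpermD //; last by rewrite eq_sym.
  by apply: contraTneq ij => ->; rewrite ltnn.
by rewrite conjgE tpermV !mulgA tperm2 mul1g.
Qed.

Variable f : {mpoly rat[N]}.
Hypothesis jm : forall i, jucys_murphy i f = content i *: f.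

(* The vectors [f] and [s f - f] are eigenvectors of a self-adjoint operator for
   distinct eigenvalues, hence orthogonal; as [s] is an isometry, [s f = f]. *)
Lemma jucys_murphy_adjacent i i' : i' = i.+1 :> nat -> rw i = rw i' ->
  msym (tperm i i') f = f.
Proof.
move=> ii' ri; set sf := msym _ f.
have sfE : dot f sf = dot f f.
  have : dot f (jucys_murphy i sf) = content i * dot f sf.
    by rewrite -dot_jucys_murphy jm dotZl.
  rewrite jucys_murphy_succ // jm msymZ dotDr dotZr -/sf.
  by rewrite (content_succ ii' ri) [RHS]mulrDl mul1r => /addrI.
apply/esym/eqP; rewrite -subr_eq0 -dot_eq0 dotBl !dotBr.
by rewrite sfE dot_msym [dot sf f]dotC sfE !subrr.
Qed.

(** By [rw_decr] a row occupies consecutive positions, so adjacent transpositions generate its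
    symmetric group. *)
Lemma jucys_murphy_row_invariant : row_invariant rw f.
Proof.
suff H n i j : j = (i + n)%N :> nat -> rw i = rw j -> msym (tperm i j) f = f.
  move=> i j rij; have [ij|/ltnW ji] := leqP i j; first by apply: (H (j - i)%N); lia.
  by rewrite tpermC; apply: (H (i - j)%N); lia.
elim: n j => [|n IH] j ij rij.
  by have -> : i = j; [apply/val_inj; rewrite /= ij addn0|rewrite tperm1 msym1m].
have [n0|n0] := posnP n; first by apply: jucys_murphy_adjacent => //; lia.
have j'N : (i + n < N)%N by have := ltn_ord j; lia.
pose j' := Ordinal j'N.
have rj' : rw i = rw j'.
  by apply/eqP; rewrite eqn_leq {1}rij !rw_decr //=; lia.
have -> : tperm i j = (tperm i j' ^ tperm j' j)%g.
  rewrite tpermJ tpermL tpermD //.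
    by rewrite -val_eqE /=; lia.
  by rewrite -val_eqE /=; lia.
have adj : msym (tperm j' j) f = f.
  by apply: jucys_murphy_adjacent; rewrite ?ij ?addnS // -rj'.
by rewrite conjgE tpermV !msymMm adj IH // adj.
Qed.

(** [tperm q i] exchanges [f] with the term of [q], and fixes every other term because [f] is
    row-invariant. *)
Lemma row_sum_invariant i r q : (r < rw i)%N -> rw q = r ->
  msym (tperm q i) (row_sum rw i r f) = row_sum rw i r f.
Proof.
move=> ri rq; have qi : q != i by apply: contraTneq ri => <-; rewrite rq ltnn.
rewrite /row_sum (bigD1 q) ?rq ?eqxx //= !msymD.
rewrite [X in _ + (_ + X) = _]msym_sum msym_tpermK addrCA.
congr (_ + (_ + _)).
apply: eq_bigr => q' /andP[/eqP rq' q'q]; rewrite -msymMm.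
have -> : (tperm q' i * tperm q i = tperm q' q * tperm q' i)%g.
  have -> : tperm q i = (tperm q' q ^ tperm q' i)%g.
    rewrite tpermJ tpermL tpermD 1?tpermC // eq_sym //.
  by rewrite conjgE tpermV !mulgA tperm2 mul1g.
by rewrite msymMm jucys_murphy_row_invariant // rq' rq.
Qed.

Lemma dot_row_sum i r : (r < rw i)%N ->
  dot (row_sum rw i r f) (row_sum rw i r f) =
  (#|[pred q | rw q == r]|.+1)%:R * dot f (row_sum rw i r f).
Proof.
move=> ri; set y := row_sum rw i r f; rewrite {1}/y /row_sum dotDl dot_suml.
rewrite (eq_bigr (fun=> dot f y)); last first.
  by move=> q /eqP rq; rewrite -dot_tperm row_sum_invariant.
by rewrite sumr_const -mulrS mulr_natl.
Qed.

(* Each [row_sum rw i r f] has a nonnegative inner product with [f], by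
   [dot_row_sum], and for fixed [i] these inner products add up to [0]. *)
Lemma jucys_murphy_row_vector : row_vector rw f.
Proof.
split=> [|i r ri]; first exact: jucys_murphy_row_invariant.
have ge0 (k : 'I_(rw i)) : 0 <= dot f (row_sum rw i k f).
  rewrite -(pmulr_rge0 _ (ltr0Sn rat #|[pred q | rw q == k]|)) -dot_row_sum //.
  exact: dot_ge0.
suff s0 : \sum_(k < rw i) dot f (row_sum rw i k f) = 0.
  have := s0; move/eqP; rewrite psumr_eq0 => [/allP/(_ (Ordinal ri))|//].
  rewrite mem_index_enum => /(_ isT) /= /eqP d0.
  by apply/eqP; rewrite -dot_eq0 dot_row_sum // d0 mulr0.
rewrite -dot_sumr /row_sum big_split /= sumr_const card_ord.
have -> : \sum_(k < rw i) \sum_(q | rw q == k) msym (tperm q i) f =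
    \sum_(q | (rw q < rw i)%N) msym (tperm q i) f.
  rewrite (exchange_big_dep (fun q => (rw q < rw i)%N)) /=; last first.
    by move=> k q _ /eqP ->.
  apply: eq_bigr => q rq; exact: (big_pred1 (Ordinal rq)).
(* A later position lies in a row above that of [i] or in the same row, where its transposition
   fixes [f]. Comparison with the content leaves [- rw i] times [f] for the rows above, which
   cancels the [rw i] copies of [f]. *)
have : jucys_murphy i f = \sum_(q | (rw q < rw i)%N) msym (tperm q i) f +
    #|[set q : 'I_N | (i < q)%N & rw q == rw i]|%:R *: f.
  rewrite /jucys_murphy (bigID (fun q => rw q == rw i)) /= addrC; congr (_ + _).
    apply: eq_big => [q|q _]; last by rewrite tpermC.
    have := @rw_decr i q; have := @rw_decr q i.
    by case: (ltngtP i q); case: (ltngtP (rw q) (rw i)) => //=; lia.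
  rewrite (eq_bigr (fun=> f)); last first.
    by move=> q /andP[_ /eqP rq]; rewrite jucys_murphy_row_invariant.
  by rewrite sumr_const scaler_nat cardsE.
rewrite jm /content scalerBl [RHS]addrC => /addrI <-.
by rewrite scaler_nat subrr linear0.
Qed.

End JucysMurphy.

(** * Counting values below a bound *)

Section Counting.
Variable T : finType.
Implicit Types (A : {set T}) (f : T -> nat).

Lemma leq_card_below A f r :
  {in A &, injective f} -> {in A, forall x, (f x < r)%N} -> (#|A| <= r)%N.
Proof.
move=> injf fr; rewrite cardE -(size_map f) -[r in (_ <= r)%N](size_iota 0).
apply: uniq_leq_size => [|y /mapP[x]].
  by rewrite map_inj_in_uniq ?enum_uniq // => x y; rewrite !mem_enum; exact: injf.
by rewrite mem_enum => /fr xr ->; rewrite mem_iota.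
Qed.

Lemma geq_card_onto A f r :
  (forall y, (y < r)%N -> exists2 x, x \in A & f x = y) -> (r <= #|A|)%N.
Proof.
move=> onto; rewrite cardE -(size_map f) -[r in (r <= _)%N](size_iota 0).
apply: uniq_leq_size (iota_uniq 0 r) _ => y; rewrite mem_iota add0n => /onto[x xA <-].
by apply: map_f; rewrite mem_enum.
Qed.

Definition below f r := #|[set x | (f x < r)%N]|.

(** Each [x] contributes [f x] to the first sum and is counted [B - f x] times in the second. *)
Lemma sum_below f B : (forall x, f x <= B)%N ->
  (\sum_x f x + \sum_(r < B) below f r.+1 = #|T| * B)%N.
Proof.
move=> fB; have E (r : 'I_B) : below f r.+1 = (\sum_x (f x <= r))%N.
  rewrite /below -sum1_card big_mkcond /=.
  by apply: eq_bigr => x _; rewrite inE ltnS; case: leqP.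
rewrite (eq_bigr _ (fun r _ => E r)) exchange_big -big_split /= -sum_nat_const.
apply: eq_bigr => x _; rewrite -[RHS](subnKC (fB x)); congr (_ + _)%N.
elim: {E fB} B => [|B IH]; first by rewrite big_ord0.
by rewrite big_ord_recr /= IH; case: leqP; lia.
Qed.

Section Domination.
Variables f g : T -> nat.
Hypothesis fg : forall r, (below f r <= below g r)%N.

Lemma below_leq_sum : (\sum_x g x <= \sum_x f x)%N.
Proof.
pose B := (\max_x f x + \max_x g x)%N.
have fB x : (f x <= B)%N by rewrite (leq_trans (leq_bigmax x)) // leq_addr.
have gB x : (g x <= B)%N by rewrite (leq_trans (leq_bigmax x)) // leq_addl.
have := sum_below fB; rewrite -(sum_below gB) => e.
by rewrite -(leq_add2r (\sum_(r < B) below f r.+1)) e leq_add2l leq_sum.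
Qed.

(** By [sum_below] the counts have equal totals; being comparable termwise, they agree. *)
Lemma below_eq_sum r : (\sum_x f x <= \sum_x g x)%N -> below f r = below g r.
Proof.
move=> le; case: r => [|r]; first by rewrite /below !eq_card0 // => x; rewrite inE.
(* [B] also exceeds [r], so that the count at [r.+1] is a term of the sums. *)
pose B := (\max_x f x + \max_x g x + r.+1)%N.
have fB x : (f x <= B)%N.
  by rewrite (leq_trans (leq_bigmax x)) // /B -addnA leq_addr.
have gB x : (g x <= B)%N.
  by rewrite (leq_trans (leq_bigmax x)) // /B addnAC leq_addl.
have rB : (r < B)%N by rewrite /B; lia.
have := sum_below fB; rewrite -(sum_below gB) => e.
have le' : (\sum_(r < B) below g r.+1 <= \sum_(r < B) below f r.+1)%N by lia.
apply/eqP; rewrite eqn_leq fg /=.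
rewrite leqNgt; apply: contraTN le' => lt; rewrite -ltnNge.
rewrite (bigD1 (Ordinal rB)) //= [X in (_ < X)%N](bigD1 (Ordinal rB)) //=.
by rewrite -addSn leq_add // leq_sum.
Qed.

End Domination.

Lemma count_below f v : count_mem v [seq f x | x : T] = (below f v.+1 - below f v)%N.
Proof.
have -> : count_mem v [seq f x | x : T] = #|[set x | f x == v]|.
  rewrite count_map -sum1_count -sum1_card big_enum_cond /=.
  by apply: eq_bigl => x; rewrite inE.
rewrite /below -(cardsID [set x | (f x < v)%N] [set x | (f x < v.+1)%N]).
have -> : [set x | (f x < v.+1)%N] :&: [set x | (f x < v)%N] = [set x | (f x < v)%N].
  by apply/setP => x; rewrite !inE; lia.
by rewrite addKn; congr #|pred_of_set _|; apply/setP => x; rewrite !inE; lia.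
Qed.

End Counting.

Lemma perm_of_below N (f g : 'I_N -> nat) :
  (forall r, below f r = below g r) -> exists w : 'S_N, forall i, f i = g (w i).
Proof.
move=> fg; have : perm_eq [seq f i | i : 'I_N] [tuple g i | i < N].
  by apply/allP => v _ /=; rewrite !count_below !fg.
case/tuple_permP => w e; exists w => i.
have /(congr1 (fun s => tnth s i)) :
    [tuple f i | i < N] = [tuple tnth [tuple g i | i < N] (w i) | i < N].
  exact: val_inj.
by rewrite !tnth_mktuple.
Qed.

(** * Specht polynomials and their monomials *)

Section Specht.
Variables (N : nat) (tau : seq nat).
Hypothesis tau_size : sumn tau = N.
Hypothesis tau_sorted : forall i j, (i <= j)%N -> (nth 0 tau j <= nth 0 tau i)%N.
Implicit Types (t w : 'S_N) (k q : 'I_N) (m : 'X_{1..N}).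

Let ri k := reshape_index tau k.
Let ci k := reshape_offset tau k.

Lemma cell_inj k k' : ri k = ri k' -> ci k = ci k' -> k = k'.
Proof.
move=> er ec; apply/val_inj; rewrite /= -(reshape_indexK tau k).
by rewrite -(reshape_indexK tau k') -/(ri k) er -/(ci k) ec.
Qed.

Lemma cell_above k r : (r <= ri k)%N -> exists2 k', ri k' = r & ci k' = ci k.
Proof.
move=> rk; have kN : (k < sumn tau)%N by rewrite tau_size.
have lt : (ci k < nth 0 tau r)%N.
  exact: leq_trans (reshape_offsetP kN) (tau_sorted rk).
have k'N : (flatten_index tau r (ci k) < N)%N by rewrite -tau_size flatten_indexP.
exists (Ordinal k'N); first exact: flatten_indexKl.
exact: flatten_indexKr.
Qed.

Lemma msym_specht_poly t w : msym w (specht_poly tau t) = specht_poly tau (t * w).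
Proof.
rewrite /specht_poly (rmorph_prod (msym w)); apply: eq_bigr => k _.
rewrite (rmorph_prod (msym w)); apply: eq_bigr => k' _.
by rewrite [LHS](msymB w) !msym_Xvar !permM.
Qed.

(** The factor of the pair [(k, k')] changes sign. The other factors are permuted without sign,
    because no row lies between those of [k] and [k']. *)
Lemma specht_poly_adjacent k k' t : ci k = ci k' -> ri k' = (ri k).+1 ->
  specht_poly tau (tperm k k' * t) = - specht_poly tau t.
Proof.
move=> ec er.
pose c (p : 'I_N * 'I_N) := (ci p.1 == ci p.2) && (ri p.1 < ri p.2)%N.
have E u : specht_poly tau u = \prod_(p | c p) ('X_(u p.1) - 'X_(u p.2)).
  by rewrite /specht_poly pair_big_dep.
have ckk : c (k, k') by rewrite /c /= ec er eqxx leqnn.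
rewrite !E (bigD1 (k, k')) //= [in RHS](bigD1 (k, k')) //=.
rewrite !permM tpermL tpermR -mulNr opprB; congr (_ * _).
pose s := tperm k k'.
pose h (p : 'I_N * 'I_N) := (s p.1, s p.2).
have hK : involutive h by case=> a b; rewrite /h /= !tpermK.
have hc p : c p && (p != (k, k')) -> c (h p) && (h p != (k, k')).
  case: p => a b; rewrite /c /h /= => /andP[/andP[/eqP eab lab] nab].
  have cs a' : ci (s a') = ci a' by rewrite /s; case: tpermP => [->|->|].
  rewrite !cs eab eqxx /=.
  have rk : k != k' by apply: contra_eqN er => /eqP ->; rewrite neq_ltn leqnn.
  rewrite xpair_eqE in nab *.
  have [ak|ak] := eqVneq a k.
    subst a; have kb : k != b by apply: contraTneq lab => <-; rewrite ltnn.
    have k'b : k' != b by rewrite eqxx /= eq_sym in nab.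
    rewrite /s tpermL (tpermD kb k'b) er xpair_eqE (eq_sym b k') (negPf k'b).
    rewrite andbF andbT ltn_neqAle lab andbT.
    apply: contraNneq k'b => e; apply/eqP/cell_inj; last by rewrite -eab.
    by rewrite er.
  have [ak'|ak'] := eqVneq a k'.
    subst a; rewrite /s tpermR xpair_eqE.
    have kb : k != b by apply: contraTneq lab => <-; rewrite er; lia.
    have k'b : k' != b by apply: contraTneq lab => <-; rewrite ltnn.
    by rewrite (tpermD kb k'b) (eq_sym b k') (negPf k'b) andbF andbT; lia.
  have sa : s a = a by rewrite /s tpermD // eq_sym.
  rewrite sa xpair_eqE (negPf ak) /= andbT /s.
  case: tpermP => [bk|bk'|//]; last first.
    have : ri a != ri k.
      by apply: contraNneq ak => e; apply/eqP/cell_inj => //; rewrite eab bk' ec.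
    by move: lab; rewrite bk' er; lia.
  by move: lab; rewrite bk er; lia.
rewrite (reindex_inj (inv_inj hK)) /=; apply: eq_big => [p|p _].
  by apply/idP/idP => [/hc|/hc //]; rewrite hK.
by rewrite /= !permM !tpermK.
Qed.

(** Induction on the distance of the rows: conjugating a shorter exchange by an adjacent one makes
    three sign changes. *)
Lemma specht_poly_tperm k k' t : k != k' -> ci k = ci k' ->
  specht_poly tau (tperm k k' * t) = - specht_poly tau t.
Proof.
suff H n : forall k k' t, ri k' = (ri k + n.+1)%N -> ci k = ci k' ->
    specht_poly tau (tperm k k' * t) = - specht_poly tau t.
  move=> kk' ec; have [lt|lt|e] := ltngtP (ri k) (ri k').
  - by apply: (H (ri k' - ri k).-1) => //; lia.
  - by rewrite tpermC; apply: (H (ri k - ri k').-1) => //; lia.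
  - by case/eqP: kk'; apply: cell_inj.
elim: n => [|n IH] {}k {}k' {}t er ec.
  by apply: specht_poly_adjacent; rewrite // er addn1.
have [|k'' er' ec'] := @cell_above k' (ri k + n.+1); first by lia.
have adj u : specht_poly tau (tperm k'' k' * u) = - specht_poly tau u.
  by apply: specht_poly_adjacent => //; lia.
have -> : tperm k k' = (tperm k k'' ^ tperm k'' k')%g.
  rewrite tpermJ tpermL tpermD //; first by apply: contra_eqN er' => /eqP ->; lia.
  by apply: contra_eqN er => /eqP ->; lia.
rewrite conjgE tpermV -!mulgA adj IH ?adj ?opprK //.
by rewrite ec' ec.
Qed.

Lemma mcoeff_specht_tperm t k k' m : k != k' -> ci k = ci k' ->
  (specht_poly tau t)@_[multinom m (tperm (t k) (t k') i) | i < N] =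
  - (specht_poly tau t)@_m.
Proof.
move=> kk' ec; rewrite -mcoeff_sym msym_specht_poly.
have -> : (t * tperm (t k) (t k') = tperm k k' * t)%g.
  by rewrite -tpermJ conjgE !mulgA mulgV mul1g.
by rewrite specht_poly_tperm // mcoeffN.
Qed.

Definition column_injective t m :=
  forall k k', ci k = ci k' -> m (t k) = m (t k') -> k = k'.

Lemma column_injectivePn t m : column_injective t m \/
  exists k k', [/\ k != k', ci k = ci k' & m (t k) = m (t k')].
Proof.
have [/existsP[k /existsP[k' /and3P[? /eqP ? /eqP ?]]]|no] := boolP
    [exists k, exists k', [&& k != k', ci k == ci k' & m (t k) == m (t k')]].
  by right; exists k, k'.
left=> k k' ec em; apply/eqP; apply: contraNT no => kk'.
by apply/existsP; exists k; apply/existsP; exists k'; rewrite kk' ec em !eqxx.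
Qed.

Lemma msupp_specht_injective t m :
  m \in msupp (specht_poly tau t) -> column_injective t m.
Proof.
rewrite mcoeff_msupp; have [//|[k [k' [kk' ec em]]]] := column_injectivePn t m.
have := mcoeff_specht_tperm t m kk' ec.
have -> : [multinom m (tperm (t k) (t k') i) | i < N] = m.
  by apply/mnmP => i; rewrite mnmE; case: tpermP => [->|->|].
by move/eqP; rewrite -subr_eq0 opprK -mulr2n mulrn_eq0 /= => ->.
Qed.

(** Column by column: a column reaching row [r] has [r] cells above that row and at most [r]
    distinct exponents below [r]; a shorter column has all its cells above row [r]. *)
Lemma column_injective_below t m r : column_injective t m ->
  (below (fun k => m (t k)) r <= below ri r)%N.
Proof.
move=> inj; have colN k : (ci k < N)%N.
  exact: leq_ltn_trans (leq_subr _ _) (ltn_ord k).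
pose col k := Ordinal (colN k).
have colE k k' : (col k == col k') = (ci k == ci k') by [].
have E f : below f r = (\sum_j #|[set k : 'I_N | (f k < r)%N & col k == j]|)%N.
  rewrite /below -sum1_card (partition_big col xpredT) //=.
  by apply: eq_bigr => j _; rewrite -sum1_card; apply: eq_bigl => k; rewrite !inE.
rewrite !E; apply: leq_sum => j _.
have [/existsP[k /andP[kj rk]]|no] := boolP [exists k, (col k == j) && (r <= ri k)%N].
  apply: (@leq_trans r).
    apply: (@leq_card_below _ _ (fun k => m (t k))).
      move=> a b; rewrite !inE => /andP[_ aj] /andP[_ bj]; apply: inj.
      by apply/eqP; rewrite -colE (eqP aj) (eqP bj).
    by move=> a; rewrite inE => /andP[].
  apply: (@geq_card_onto _ _ ri) => y yr.
  have [|k' er ec] := @cell_above k y; first by lia.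
  exists k' => //; rewrite inE er yr /= -(eqP kj) colE ec //.
apply/subset_leq_card/subsetP => k; rewrite !inE => /andP[_ kj]; rewrite kj andbT.
rewrite ltnNge; apply: contra no => rk; apply/existsP; exists k.
by rewrite kj.
Qed.

Lemma mdeg_perm t m : mdeg m = (\sum_k m (t k))%N.
Proof. by rewrite mdegE (reindex_inj (@perm_inj _ t)). Qed.

Lemma column_injective_mdeg t m : column_injective t m -> (\sum_k ri k <= mdeg m)%N.
Proof.
move=> inj; rewrite (mdeg_perm t); apply: below_leq_sum => r.
exact: column_injective_below.
Qed.

(** A cell has at most as many cells above it in its column as its row number. The bound meets the
    one of [column_injective_mdeg], so the degree is the least possible. *)
Lemma specht_poly_homog t : exists2 d,
  (d <= \sum_k ri k)%N & specht_poly tau t \is d.-homog.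
Proof.
pose c k k' := (ci k == ci k') && (ri k < ri k')%N.
exists (\sum_k \sum_(k' | c k k') 1)%N.
  rewrite (exchange_big_dep xpredT) //=; apply: leq_sum => k' _.
  rewrite sum1_card -cardsE; apply: (@leq_card_below _ _ ri).
    move=> a b; rewrite !inE => /andP[/eqP ea _] /andP[/eqP eb _] er.
    by apply: cell_inj => //; rewrite ea eb.
  by move=> a; rewrite inE => /andP[].
have HM (p p' : {mpoly rat[N]}) d d' :
    p \is d.-homog -> p' \is d'.-homog -> p * p' \is (d + d').-homog.
  exact: dhomogM.
apply: (big_ind2 (fun (p : {mpoly rat[N]}) d => p \is d.-homog)).
- exact: dhomog1.
- by move=> p d p' d'; apply: HM.
move=> k _; apply: (big_ind2 (fun (p : {mpoly rat[N]}) d => p \is d.-homog)).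
- exact: dhomog1.
- by move=> p d p' d'; apply: HM.
by move=> k' _; apply: rpredB; rewrite dhomogX /= mdeg1.
Qed.

(** [rev_ord] puts the last position into the first cell, in keeping with Jucys-Murphy elements that
    sum over later positions. *)
Definition row_monomial : 'X_{1..N} := [multinom ri (rev_ord i) | i < N].

Lemma mdeg_row_monomial : mdeg row_monomial = (\sum_k ri k)%N.
Proof.
rewrite mdegE (reindex_inj rev_ord_inj) /=; apply: eq_bigr => k _.
by rewrite mnmE rev_ordK.
Qed.

(** Minimality of the degree is the equality case of [column_injective_below]: the exponents are the
    row numbers of the cells, permuted. *)
Lemma msupp_specht_orbit t m : m \in msupp (specht_poly tau t) ->
  exists w, m = [multinom row_monomial (w i) | i < N].
Proof.
move=> sm; have inj := msupp_specht_injective sm.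
have [d le /dhomogP/(_ _ sm) dm] := specht_poly_homog t.
have [w hw] : exists w : 'S_N, forall k, m (t k) = ri (w k).
  apply: perm_of_below => r; apply: below_eq_sum.
    by move=> r'; apply: column_injective_below.
  by rewrite -mdeg_perm dm.
exists (t^-1 * w * perm rev_ord_inj)%g; apply/mnmP => i.
by rewrite !mnmE !permM permE rev_ordK -hw permKV.
Qed.

Definition row_of i := ri (rev_ord i).

(** Lowering the exponent of [i] to [r] in [row_monomial] gives [b]; raising one exponent [r] of [b]
    to [row_of i] gives the monomials of the sum. The degree of [b] is too small for distinct
    exponents in each column of [t], so an exchange within a column fixes [b]. It permutes the terms
    and negates the coefficients, whence [S = - S]. *)
Lemma mcoeff_specht_row_sum i r t : (r < row_of i)%N ->
  (specht_poly tau t)@_row_monomial + \sum_(q | row_of q == r)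
    (specht_poly tau t)@_[multinom row_monomial (tperm q i j) | j < N] = 0.
Proof.
move=> ri_r; set P := specht_poly tau t.
pose b j := if j == i then r else row_of j.
pose g q : 'X_{1..N} := [multinom if j == q then row_of i else b j | j < N].
pose S := \sum_(q | b q == r) P@_(g q).
have bi : b i = r by rewrite /b eqxx.
have bn j : j != i -> b j = row_of j by rewrite /b => /negPf ->.
have -> : P@_row_monomial + \sum_(q | row_of q == r)
    P@_[multinom row_monomial (tperm q i j) | j < N] = S.
  rewrite /S [RHS](bigD1 i) /=; last by rewrite bi.
  congr (_ + _).
    by congr (P@_ _); apply/mnmP => j; rewrite !mnmE; have [->|/bn ->] := eqVneq j i.
  apply: eq_big => [q|q /eqP rq].
    have [->|/bn ->] := eqVneq q i; last by rewrite andbT.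
    by rewrite andbF; apply: gtn_eqF.
  have qi : q != i by apply: contraTneq ri_r => <-; rewrite rq ltnn.
  congr (P@_ _); apply/mnmP => j; rewrite !mnmE.
  case: tpermP => [->|->|/eqP jq /eqP ji]; rewrite ?eqxx //.
    by rewrite eq_sym (negPf qi) bi -rq.
  by rewrite (negPf jq) bn.
pose bm : 'X_{1..N} := [multinom b j | j < N].
have lt : (mdeg bm < \sum_k ri k)%N.
  rewrite -mdeg_row_monomial !mdegE (bigD1 i) //= [X in (_ < X)%N](bigD1 i) //=.
  rewrite !mnmE bi -addSn leq_add // leq_sum // => j ji.
  by rewrite !mnmE bn.
have [/column_injective_mdeg|[k [k' [kk' ec]]]] := column_injectivePn t bm.
  by rewrite leqNgt lt.
rewrite !mnmE => eb.
pose s := tperm (t k) (t k').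
have bs j : b (s j) = b j by rewrite /s; case: tpermP => [->|->|].
suff : S = - S.
  by move/eqP; rewrite -subr_eq0 opprK -mulr2n mulrn_eq0 /= => /eqP.
rewrite {1}/S (reindex_inj (@perm_inj _ s)) /= /S -sumrN.
apply: eq_big => [q|q _]; first by rewrite bs.
rewrite -(mcoeff_specht_tperm t _ kk' ec); congr (P@_ _).
apply/mnmP => j; rewrite !mnmE -/s bs.
by rewrite -[in LHS](inj_eq (@perm_inj _ s)) tpermK.
Qed.

Lemma specht_cyclic (f : {mpoly rat[N]}) :
  specht tau f <-> cyclic_span (specht_poly tau 1) f.
Proof.
split=> -[c ->]; exists c; apply: eq_bigr => w _.
  by rewrite msym_specht_poly mul1g.
by rewrite msym_specht_poly mul1g.
Qed.

Lemma specht_poly_neq0 t : specht_poly tau t != 0.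
Proof.
apply/prodf_neq0 => k _; apply/prodf_neq0 => k' /andP[_ rk].
rewrite subr_eq0; apply: contraTneq rk => /(congr1 (mcoeff U_(t k))).
rewrite !mcoeffXU eqxx; have [/perm_inj ->|_] := eqVneq (t k') (t k).
  by rewrite ltnn.
by move/eqP; rewrite oner_eq0.
Qed.

Lemma dotXl m (v : {mpoly rat[N]}) : dot 'X_[m] v = v@_m.
Proof. by rewrite /dot msuppX big_seq1 mcoeffX eqxx mul1r. Qed.

(* [g] is the orthogonal projection to the Specht module of the monomial in which
   the exponent of each variable is its row. *)
Lemma specht_row_generator : exists2 g, row_vector row_of g /\ g != 0 &
  forall f, specht tau f <-> cyclic_span g f.
Proof.
pose p1 := @specht_poly N tau 1; pose X : {mpoly rat[N]} := 'X_[row_monomial].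
have [g p1g orth] := cyclic_span_decomp X p1.
have sp := cyclic_span_submodule p1.
(* [act x] keeps [X - g] orthogonal to the Specht module. *)
have actg x v : cyclic_span p1 v -> dot (act x g) v = dot (act x X) v.
  move=> pv; have := cyclic_span_act_orthogonal x orth pv.
  by rewrite linearB /= dotBl => /eqP; rewrite subr_eq0 => /eqP ->.
have act0 x : (forall t, dot (act x X) (specht_poly tau t) = 0) -> act x g = 0.
  move=> h; have pg : cyclic_span p1 (act x g) by exact: submodule_act.
  apply/eqP; rewrite -dot_eq0 actg //; case: pg => c ->.
  apply/eqP/dot_sum_eq0 => t; right; rewrite /p1 msym_specht_poly mul1g; exact: h.
have gv : row_vector row_of g.
  split=> [i j rij|i r ri_r].
    have [x hx] := row_invariant_act i j; apply/esym/eqP; rewrite -subr_eq0 hx.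
    apply/eqP/act0 => t; rewrite -hx.
    have -> : msym (tperm i j) X = X.
      rewrite /X msymX tpermV; congr 'X_[_]; apply/mnmP => k.
      by rewrite !mnmE; case: tpermP => [->|->|]; rewrite // -/(row_of _) rij.
    by rewrite subrr dot0l.
  have [x hx] := row_sum_act row_of i r; rewrite hx; apply: act0 => t.
  rewrite -hx /row_sum dotDl dot_suml dotXl.
  rewrite -[RHS](mcoeff_specht_row_sum t ri_r); congr (_ + _).
  by apply: eq_bigr => q _; rewrite -dot_tperm dotXl mcoeff_sym.
(* The monomials of [p1] are permuted copies of [X], so [p1 = act c X] for some [c]; projecting to
   the Specht module gives [p1 = act c g]. *)
have p1g' : cyclic_span g p1.
  have [c hc] : cyclic_span X p1.
    rewrite [p1]mpolyE big_seq; apply: submodule_sum => [|m sm].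
      exact: cyclic_span_submodule.
    apply: submoduleZ; first exact: cyclic_span_submodule.
    have [w ->] := msupp_specht_orbit sm.
    have -> : 'X_[[multinom row_monomial (w i) | i < N]] = msym w^-1 X.
      by rewrite /X msymX invgK.
    case: (cyclic_span_submodule X) => _ _; apply; exact: cyclic_span_id.
  exists c; apply/eqP; rewrite -subr_eq0 -dot_eq0.
  have pp : cyclic_span p1 (p1 - act c g).
    apply: submoduleB => //; first exact: cyclic_span_id.
    exact: submodule_act.
  by rewrite dotBl actg // -hc subrr.
exists g.
  split=> //; apply: contraNneq (specht_poly_neq0 1) => g0.
  by case: p1g' => c; rewrite g0 linear0 => /eqP.
move=> f; split=> [/specht_cyclic|gf].
  exact: (cyclic_span_sub (cyclic_span_submodule g)).
by apply/specht_cyclic; exact: cyclic_span_sub gf.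
Qed.

Lemma row_vector_of_isotype d (f : {mpoly rat[N]}) :
  row_vector row_of f -> f != 0 -> f \is d.-homog -> of_isotype tau f.
Proof.
move=> fv fn0 fd; have [g [gv gn0] sg] := specht_row_generator.
exists d, (cyclic_span f); split.
- move=> u [x ->]; apply: rpred_sum => w _; apply: rpredZ.
  apply/dhomogP => m; rewrite mcoeff_msupp mcoeff_sym -mcoeff_msupp => sm.
  by rewrite -(dhomog_mf fd sm); apply/esym/mdeg_mperm.
- exact: row_vector_irreducible fv fn0.
- have [phi [eqv inj im]] := row_vector_isomorphic fv gv fn0 gn0.
  by exists phi; split=> // v; split=> [/sg/im|/im/sg].
- exact: cyclic_span_id.
Qed.

End Specht.

(** * Dunkl operators with denominators cleared *)

Section Dunkl.
Variables (K : fieldType) (N : nat) (k : K).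
Implicit Types (f z : {mpoly K[N]}) (i j : 'I_N).

Notation tofracP := (@tofrac {mpoly K[N]}).

(** Specialization acts on coefficients of polynomials, while [dunkl] takes values in fractions;
    this common denominator turns the eigenvalue equation into one between polynomials. *)
Definition dunkl_denominator i : {mpoly K[N]} := \prod_(j | j != i) ('X_i - 'X_j).

Definition dunkl_numerator i f : {mpoly K[N]} :=
  f^`M(i) * dunkl_denominator i + k *: \sum_(j | j != i)
    (f - msym (tperm i j) f) * \prod_(j' | (j' != i) && (j' != j)) ('X_i - 'X_j').

Lemma subX_neq0 i j : j != i -> 'X_i - 'X_j != 0 :> {mpoly K[N]}.
Proof.
move=> ji; rewrite subr_eq0; apply/eqP => /(congr1 (mcoeff U_(i))) /eqP.
by rewrite !mcoeffXU eqxx (negPf ji) oner_eq0.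
Qed.

Lemma dunkl_denominator_neq0 i : dunkl_denominator i != 0.
Proof. by apply/prodf_neq0 => j; apply: subX_neq0. Qed.

Lemma dunkl_clear_denominator i f :
  dunkl k i f * tofracP (dunkl_denominator i) = tofracP (dunkl_numerator i f).
Proof.
rewrite /dunkl /dunkl_numerator mulrDl rmorphD rmorphM /=; congr (_ + _).
rewrite -mul_mpolyC rmorphM /= -mulrA; congr (_ * _).
rewrite mulr_suml rmorph_sum /=; apply: eq_bigr => j ji.
rewrite /dunkl_denominator (bigD1 j) //= !rmorphM /= mulrA divfK //.
by rewrite tofrac_eq0 subX_neq0.
Qed.

(** With [g = msym (tperm i j) f], one has ['X_i * f - 'X_j * g = 'X_i * (f - g) + ('X_i - 'X_j) *
    g], and the last factor cancels the denominator. *)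
Lemma dunkl_mulX i f : dunkl k i ('X_i * f) = tofracP 'X_i * dunkl k i f +
  tofracP (f + k *: \sum_(j | j != i) msym (tperm i j) f).
Proof.
rewrite /dunkl mderivM mderivX mnm1E eqxx scale1r.
have -> : (U_(i) - U_(i) = 0 :> 'X_{1..N})%MM.
  by apply/mnmP => j; rewrite mnmBE subnn mnm0E.
rewrite mpolyX0 mul1r.
have -> : \sum_(j | j != i) tofracP ('X_i * f - msym (tperm i j) ('X_i * f)) /
    tofracP ('X_i - 'X_j) = tofracP 'X_i * (\sum_(j | j != i)
      tofracP (f - msym (tperm i j) f) / tofracP ('X_i - 'X_j)) +
    tofracP (\sum_(j | j != i) msym (tperm i j) f).
  rewrite mulr_sumr rmorph_sum -big_split /=; apply: eq_bigr => j ji.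
  rewrite msymM msym_Xvar tpermL.
  have n0 : tofracP ('X_i - 'X_j) != 0 by rewrite tofrac_eq0 subX_neq0.
  apply: (mulIf n0); rewrite mulrDl mulrA !divfK // -!rmorphM -rmorphD /=.
  by congr (tofracP _); ring.
rewrite -mul_mpolyC !(rmorphD, rmorphM) /=; ring.
Qed.

(** Of the transpositions produced by [dunkl_mulX], those with [j < i] cancel against the sum in
    [cherednik]. *)
Lemma cherednik_eigen i f c : cherednik k i f = tofracP (c *: f) ->
  'X_i * dunkl_numerator i f =
  (c *: f - f - k *: \sum_(j : 'I_N | (i < j)%N) msym (tperm i j) f) *
    dunkl_denominator i.
Proof.
rewrite /cherednik dunkl_mulX.
set L := \sum_(j < N | (j < i)%N) _; set G := \sum_(j : 'I_N | (i < j)%N) _.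
have -> : \sum_(j | j != i) msym (tperm i j) f = G + L.
  rewrite (bigID (fun j : 'I_N => (i < j)%N)) /=; congr (_ + _).
    by apply: eq_bigl => j; rewrite -val_eqE /=; case: ltngtP.
  apply: eq_big => [j|j _]; last by rewrite tpermC.
  by rewrite -val_eqE /=; case: ltngtP.
move=> h; apply/eqP; rewrite -tofrac_eq rmorphM /= -dunkl_clear_denominator.
rewrite mulrA rmorphM /=; apply/eqP; congr (_ * _).
have -> : tofracP (c *: f - f - k *: G) = tofracP (c *: f) - tofracP (f + k *: G).
  by rewrite -rmorphB opprD addrA.
have sub (V : zmodType) (x a b y : V) : x + (a + b) - b = y -> x = y - a.
  by move=> <-; rewrite addrA !addrK.
apply: (sub _ _ _ (tofracP (k *: L))); rewrite -h scalerDr (addrA f).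
by congr (_ + _ - _); apply/esym/tofracD.
Qed.

End Dunkl.

(** * Specialization of the parameter *)

Section Specialization.
Variable k0 : rat.
Implicit Types c d : Qkappa.

Lemma value_at_poly (p : {poly rat}) : value_at k0 (tofrac p) p.[k0].
Proof. by exists p, 1; rewrite hornerC oner_eq0 rmorph1 !divr1. Qed.

Lemma value_at_nat n : value_at k0 n%:R n%:R.
Proof.
have -> : n%:R = tofrac (n%:R : {poly rat}) :> Qkappa by rewrite rmorph_nat.
have -> : n%:R = (n%:R : {poly rat}).[k0] by rewrite -polyC_natr hornerC.
exact: value_at_poly.
Qed.

Lemma value_at_kappa : value_at k0 kappa k0.
Proof. by rewrite -[X in value_at _ _ X](hornerX k0); apply: value_at_poly. Qed.

Lemma tofrac_den_neq0 (q : {poly rat}) : q.[k0] != 0 -> tofrac q != 0.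
Proof. by rewrite tofrac_eq0; apply: contraNneq => ->; rewrite horner0. Qed.

Lemma value_atD c d u v :
  value_at k0 c u -> value_at k0 d v -> value_at k0 (c + d) (u + v).
Proof.
move=> [p [q [q0 -> ->]]] [p' [q' [q'0 -> ->]]]; exists (p * q' + p' * q), (q * q').
by rewrite hornerD !hornerM mulf_neq0 // !addf_div ?tofrac_den_neq0 // tofracD !tofracM.
Qed.

Lemma value_atM c d u v :
  value_at k0 c u -> value_at k0 d v -> value_at k0 (c * d) (u * v).
Proof.
move=> [p [q [q0 -> ->]]] [p' [q' [q'0 -> ->]]]; exists (p * p'), (q * q').
by rewrite !hornerM mulf_neq0 // !mulf_div !tofracM.
Qed.

Lemma value_atN c u : value_at k0 c u -> value_at k0 (- c) (- u).
Proof.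
by case=> p [q [q0 -> ->]]; exists (- p), q; rewrite hornerN rmorphN !mulNr.
Qed.

Lemma value_at_unique c u v : value_at k0 c u -> value_at k0 c v -> u = v.
Proof.
move=> [p [q [q0 -> ->]]] [p' [q' [q'0 e ->]]].
apply/eqP; rewrite eqr_div // -!hornerM.
have := e; move/eqP; rewrite eqr_div ?tofrac_den_neq0 // -!rmorphM /= tofrac_eq.
by move/eqP => ->.
Qed.

Section Polynomials.
Variable N : nat.
Implicit Types (z y : {mpoly Qkappa[N]}) (p q : {mpoly rat[N]}).

Lemma specializesD z y p q :
  specializes k0 z p -> specializes k0 y q -> specializes k0 (z + y) (p + q).
Proof. by move=> h h' m; rewrite !mcoeffD; apply: value_atD. Qed.

Lemma specializesN z p : specializes k0 z p -> specializes k0 (- z) (- p).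
Proof. by move=> h m; rewrite !mcoeffN; apply: value_atN. Qed.

Lemma specializesB z y p q :
  specializes k0 z p -> specializes k0 y q -> specializes k0 (z - y) (p - q).
Proof. by move=> h h'; apply: specializesD => //; apply: specializesN. Qed.

Lemma specializesZ c u z p :
  value_at k0 c u -> specializes k0 z p -> specializes k0 (c *: z) (u *: p).
Proof. by move=> h h' m; rewrite !mcoeffZ; apply: value_atM. Qed.

Lemma specializesM z y p q :
  specializes k0 z p -> specializes k0 y q -> specializes k0 (z * y) (p * q).
Proof.
move=> h h' m; rewrite !mcoeffM; apply: big_ind2 => [|????|i _].
- exact: (value_at_nat 0).
- exact: value_atD.
- exact: value_atM.
Qed.

Lemma specializes_nat n : specializes k0 n%:R (n%:R : {mpoly rat[N]}).
Proof.
move=> m; rewrite -!mpolyC_nat !mcoeffC; apply: value_atM; exact: value_at_nat.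
Qed.

Lemma specializesX i : specializes k0 'X_i ('X_i : {mpoly rat[N]}).
Proof. by move=> m; rewrite !mcoeffX; apply: value_at_nat. Qed.

Lemma specializes_msym (w : 'S_N) z p :
  specializes k0 z p -> specializes k0 (msym w z) (msym w p).
Proof. by move=> h m; rewrite !mcoeff_sym. Qed.

Lemma specializes_deriv i z p :
  specializes k0 z p -> specializes k0 z^`M(i) p^`M(i).
Proof.
move=> h m; rewrite !mcoeff_deriv.
rewrite -(mulr_natr z@__) -(mulr_natr p@__); apply: value_atM => //.
exact: value_at_nat.
Qed.

Lemma specializes_sum I (r : seq I) (P : pred I) F G :
  (forall i, P i -> specializes k0 (F i) (G i)) ->
  specializes k0 (\sum_(i <- r | P i) F i : {mpoly Qkappa[N]})
                 (\sum_(i <- r | P i) G i).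
Proof.
move=> h; apply: big_ind2 => // [|? ? ? ?]; first exact: (specializes_nat 0).
exact: specializesD.
Qed.

Lemma specializes_prod I (r : seq I) (P : pred I) F G :
  (forall i, P i -> specializes k0 (F i) (G i)) ->
  specializes k0 (\prod_(i <- r | P i) F i : {mpoly Qkappa[N]})
                 (\prod_(i <- r | P i) G i).
Proof.
move=> h; apply: big_ind2 => // [|? ? ? ?]; first exact: (specializes_nat 1).
exact: specializesM.
Qed.

Lemma specializes_unique z p q : specializes k0 z p -> specializes k0 z q -> p = q.
Proof. by move=> h h'; apply/mpolyP => m; apply: value_at_unique (h m) (h' m). Qed.

(* On a polynomial killed by the Dunkl operators, [cherednik k0 i] acts as the
   identity plus [k0] times a Jucys-Murphy element. *)
Lemma singular_jucys_murphy z p i c v :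
  specializes k0 z p -> singular k0 p -> value_at k0 c v ->
  cherednik kappa i z = tofrac (c *: z) ->
  k0 *: jucys_murphy i p = (v - 1) *: p.
Proof.
move=> zp [_ dp0] cv /cherednik_eigen e.
have sub j : specializes k0 ('X_i - 'X_j) ('X_i - 'X_j : {mpoly rat[N]}).
  by apply: specializesB; apply: specializesX.
have den : specializes k0 (dunkl_denominator Qkappa i) (dunkl_denominator rat i).
  by apply: specializes_prod.
have num : specializes k0 (dunkl_numerator kappa i z) (dunkl_numerator k0 i p).
  apply: specializesD.
    by apply: specializesM => //; apply: specializes_deriv.
  apply: specializesZ; first exact: value_at_kappa.
  apply: specializes_sum => j _; apply: specializesM.
    by apply: specializesB => //; apply: specializes_msym.
  by apply: specializes_prod.
have num0 : dunkl_numerator k0 i p = 0.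
  by apply/eqP; rewrite -tofrac_eq0 -dunkl_clear_denominator dp0 mul0r.
(* Both sides specialize the same polynomial, by the cleared eigenvalue equation [e]. *)
have : (v *: p - p - k0 *: jucys_murphy i p) * dunkl_denominator rat i =
    'X_i * dunkl_numerator k0 i p.
  apply: (@specializes_unique ('X_i * dunkl_numerator kappa i z)); last first.
    by apply: specializesM => //; apply: specializesX.
  rewrite e; apply: specializesM => //; apply: specializesB.
    by apply: specializesB => //; apply: specializesZ.
  apply: specializesZ; first exact: value_at_kappa.
  by apply: specializes_sum => j _; apply: specializes_msym.
rewrite num0 mulr0 => /eqP; rewrite mulf_eq0 (negPf (dunkl_denominator_neq0 _ _)) orbF.
by rewrite subr_eq0 scalerBl scale1r => /eqP ->.
Qed.

Lemma value_at_spectral (a : 'X_{1..N}) i :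
  value_at k0 (spectral a i) ((N%:R - (rankc a i)%:R) * k0 + (a i)%:R + 1).
Proof.
apply: value_atD; last exact: (value_at_nat 1).
apply: value_atD; last exact: value_at_nat.
apply: value_atM; last exact: value_at_kappa.
by apply: value_atD; last apply: value_atN; apply: value_at_nat.
Qed.

(** Specialization creates no monomials, and [comp_gt] relates only exponents of equal degree. *)
Lemma nsJack_homog a z p :
  is_nsJack a z -> specializes k0 z p -> p \is (mdeg a).-homog.
Proof.
move=> [_ tri _] zp; apply/dhomogP => m; rewrite mcoeff_msupp => pm.
have [-> //|ma] := eqVneq m a.
have /(tri m ma) : z@_m != 0.
  apply: contraNneq pm => zm; apply/eqP; apply: value_at_unique (zp m) _.
  by rewrite zm; apply: (value_at_nat 0).
by case/andP => /eqP.
Qed.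

End Polynomials.
End Specialization.

Lemma rankc_decreasing N (a : 'X_{1..N}) (i : 'I_N) :
  (forall j j' : 'I_N, (j <= j')%N -> (a j' <= a j)%N) -> rankc a i = i.+1.
Proof.
move=> decr_a; rewrite /rankc -cardsUI.
have -> : #|[set j : 'I_N | (a i < a j)%N] :&:
    [set j : 'I_N | (j <= i)%N && (a j == a i)]| = 0%N.
  by apply: eq_card0 => j; rewrite !inE; lia.
have -> : [set j : 'I_N | (a i < a j)%N] :|:
    [set j : 'I_N | (j <= i)%N && (a j == a i)] =
    [set j : 'I_N | (j < i.+1)%N].
  apply/setP => j; rewrite !inE ltnS.
  have := decr_a i j; have := decr_a j i.
  by case: (ltngtP i j); case: (ltngtP (a i) (a j)) => //=; lia.
rewrite addn0 cardsE -sum1_card.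
rewrite (big_ord_narrow (ltn_ord i)) /= sum1_card card_ord //.
Qed.

Lemma row_of_decreasing N tau (i j : 'I_N) :
  (i <= j)%N -> (row_of tau j <= row_of tau i)%N.
Proof.
move=> ij; have : (rev_ord j <= rev_ord i)%N by rewrite /=; lia.
by rewrite (reshape_leq tau) => /orP[/ltnW|/andP[/eqP e _]]; rewrite // /row_of e.
Qed.

(** * Contents of cells as Jucys-Murphy eigenvalues *)

Section Isotype.
Variables (N : nat) (tau : seq nat).
Hypothesis tau_size : sumn tau = N.
Hypothesis tau_sorted : forall i j, (i <= j)%N -> (nth 0 tau j <= nth 0 tau i)%N.

(** The later positions in the row of [i] fill the cells to its left, so their columns are exactly
    the numbers below the column of [i]. *)
Lemma content_row_of (i : 'I_N) : content (row_of tau) i =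
  (reshape_offset tau (rev_ord i))%:R - (row_of tau i)%:R.
Proof.
rewrite /content; congr (_%:R - _); apply/eqP; rewrite eqn_leq; apply/andP; split.
  apply: (@leq_card_below _ _ (fun q : 'I_N => reshape_offset tau (rev_ord q))).
    move=> a b; rewrite !inE => /andP[_ /eqP ra] /andP[_ /eqP rb] e.
    by apply/rev_ord_inj/(@cell_inj N tau) => //; rewrite -/(row_of tau a) ra -rb.
  move=> q; rewrite inE => /andP[iq /eqP rq].
  have := reshape_indexK tau (rev_ord q); have := reshape_indexK tau (rev_ord i).
  rewrite /flatten_index -/(row_of tau q) -/(row_of tau i) rq /=.
  by have := ltn_ord q; lia.
apply: (@geq_card_onto _ _ (fun q : 'I_N => reshape_offset tau (rev_ord q))) => y yi.
have iN : (rev_ord i < sumn tau)%N by rewrite tau_size ltn_ord.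
have yn : (y < nth 0 tau (row_of tau i))%N.
  exact: ltn_trans yi (reshape_offsetP iN).
have kN : (flatten_index tau (row_of tau i) y < N)%N.
  exact: leq_trans (flatten_indexP yn) (eq_leq tau_size).
exists (rev_ord (Ordinal kN)); last by rewrite rev_ordK /= flatten_indexKr.
rewrite inE /row_of rev_ordK flatten_indexKl // eqxx andbT.
have := reshape_indexK tau (rev_ord i).
rewrite /flatten_index -/(row_of tau i) /= in kN yi *.
by have := ltn_ord i; lia.
Qed.

Lemma jucys_murphy_of_isotype d (f : {mpoly rat[N]}) :
  f != 0 -> f \is d.-homog ->
  (forall i, jucys_murphy i f =
    ((reshape_offset tau (rev_ord i))%:R - (row_of tau i)%:R) *: f) ->
  of_isotype tau f.
Proof.
move=> fn0 fd jm; apply: (row_vector_of_isotype tau_size tau_sorted _ fn0 fd).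
apply: jucys_murphy_row_vector => [|i]; first exact: row_of_decreasing.
by rewrite content_row_of jm.
Qed.

End Isotype.

(** * The exponents of lambda along the rows of tau *)

Section Partitions.
Variables mu l m s rho N : nat.
Hypothesis rho_mu : (1 <= rho <= mu)%N.
Hypothesis N_eq : N = ((s + l + 1) * mu + s + rho)%N.

Let tau := Tau mu s l rho.

Lemma sumn_Tau : sumn tau = N.
Proof.
rewrite N_eq /tau /Tau -cat1s -cats1 !sumn_cat sumn_nseq /= !addn0; nia.
Qed.

Lemma nth_Tau r : nth 0%N tau r =
  if r == 0%N then (s * mu.+1 + mu)%N else if (r <= l)%N then mu
  else if r == l.+1 then rho else 0%N.
Proof.
case: r => [//|r] /=; rewrite nth_rcons size_nseq nth_nseq eqSS.
by case: ltnP.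
Qed.

Lemma Tau_sorted i j : (i <= j)%N -> (nth 0 tau j <= nth 0 tau i)%N.
Proof.
case/andP: rho_mu => _ rm ij; rewrite !nth_Tau.
by repeat (case: ifP => ?); nia.
Qed.

Lemma sumn_take_Tau r : (r <= l)%N ->
  sumn (take r.+1 tau) = (s * mu.+1 + mu + r * mu)%N.
Proof.
move=> rl; rewrite /= -cats1 takel_cat ?size_nseq // take_nseq //.
by rewrite sumn_nseq (mulnC mu).
Qed.

Lemma nth_flatten_nseq (F : nat -> nat) a n q t : (q < n)%N -> (t < mu)%N ->
  nth 0%N (flatten [seq nseq mu (F j) | j <- iota a n]) (q * mu + t) = F (a + q)%N.
Proof.
move=> + tm; elim: n a q => // n IH a [|q] qn /=.
  by rewrite nth_cat size_nseq tm nth_nseq tm addn0.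
rewrite nth_cat size_nseq ltnNge mulSn -addnA leq_addr /= addKn IH //.
by rewrite addSnnS.
Qed.

Lemma size_flatten_nseq (F : nat -> nat) a n :
  size (flatten [seq nseq mu (F j) | j <- iota a n]) = (n * mu)%N.
Proof. by elim: n a => // n IH a /=; rewrite size_cat size_nseq IH mulSn. Qed.

(** The blocks of [Lambda], from first to last, have the lengths of the rows of [tau] from the last
    up to row 1; the padding zeros fill row 0. *)
Lemma Lambda_row (i : 'I_N) : nth 0%N (Lambda mu s l rho m) i =
  (if row_of tau i == 0 then 0 else m * (s + row_of tau i))%N.
Proof.
case/andP: rho_mu => r0 rm.
have iN : (rev_ord i < sumn tau)%N by rewrite sumn_Tau ltn_ord.
have := reshape_indexK tau (rev_ord i); have := reshape_offsetP iN.
have := reshape_indexP iN; rewrite -/(row_of tau i) /flatten_index.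
set c := reshape_offset _ _; set r := row_of tau i.
rewrite /= size_rcons size_nseq nth_Tau.
have iN' := ltn_ord i.
case: r => [|r] /=.
  move=> _ ct e; rewrite nth_default // size_cat size_nseq size_flatten_nseq.
  by move: e; rewrite add0n; nia.
rewrite !ltnS => rl; rewrite -[(_ + sumn _)%N]/(sumn (take r.+1 tau)).
rewrite sumn_take_Tau // => ct e.
rewrite /Lambda nth_cat size_nseq.
move: ct; case: (ltnP r l) => rl' ct; last first.
  have rE : r = l by lia.
  move: ct; rewrite rE; case: ifP => [_ ct|/eqP//].
  have ir : (i < rho)%N by nia.
  by rewrite ir nth_nseq ir; congr (_ * _)%N; lia.
have ir : (i < rho)%N = false by apply/negbTE; nia.
(* Row [r.+1] is block [l - r.+1] of the flattened list; positions run against the cells, so column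
   [c] becomes offset [mu - c.+1]. *)
have -> : (i - rho = (l - r.+1) * mu + (mu - c.+1))%N by nia.
rewrite ir nth_flatten_nseq; [congr (_ * _)%N; lia | lia | lia].
Qed.

(** [N - i.+1] is the number of the cell of [i]. In row 0 it is the column [c], and the exponent is
    0. In row [r >= 1] it is [s * mu.+1 + r * mu + c]; times [k0], plus the exponent [m * (s + r)],
    this is [k0 * (c - r)]. *)
Lemma Lambda_eigenvalue (i : 'I_N) : (1 <= m)%N ->
  let k0 : rat := - (m%:R / mu.+1%:R) in
  (N%:R - i.+1%:R) * k0 + (nth 0%N (Lambda mu s l rho m) i)%:R =
  k0 * ((reshape_offset tau (rev_ord i))%:R - (row_of tau i)%:R).
Proof.
move=> m1 k0; have e := reshape_indexK tau (rev_ord i).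
have iN : (rev_ord i < sumn tau)%N by rewrite sumn_Tau ltn_ord.
have := reshape_indexP iN; rewrite Lambda_row.
move: e; rewrite -/(row_of tau i) /flatten_index.
set c := reshape_offset _ _; set r := row_of tau i => e.
have mu0 : mu.+1%:R != 0 :> rat by rewrite pnatr_eq0.
have NE : N%:R - i.+1%:R = (sumn (take r tau) + c)%N%:R :> rat.
  by rewrite e /= natrB // ltn_ord.
rewrite NE; case: r {e NE} => [|r]; first by move=> _; rewrite /= add0n; ring.
rewrite /= size_rcons size_nseq !ltnS => rl.
rewrite -[(_ + sumn _)%N]/(sumn (take r.+1 tau)) sumn_take_Tau // /k0.
rewrite !(natrD, natrM) -!natr1; field.
by rewrite natr1.
Qed.

End Partitions.

Theorem theorem6 (mu l m s rho N : nat)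
    (z : {mpoly Qkappa[N]}) (p : {mpoly rat[N]}) :
  (1 <= mu)%N -> (1 <= l)%N -> (1 <= m)%N -> (1 <= rho <= mu)%N ->
  coprime m mu.+1 ->
  N = ((s + l + 1) * mu + s + rho)%N ->
  is_nsJack (pad N (Lambda mu s l rho m)) z ->
  specializes (- (m%:R / mu.+1%:R)) z p ->
  singular (- (m%:R / mu.+1%:R)) p ->
  of_isotype (Tau mu s l rho) p.
Proof.
move=> _ _ m1 rho_mu _ N_eq jack zp sing.
have hp := nsJack_homog jack zp.
apply: (jucys_murphy_of_isotype (sumn_Tau rho_mu N_eq) _ _ hp) => [i j||i].
- exact: Tau_sorted.
- by case: sing.
(* [singular_jucys_murphy] determines the Jucys-Murphy action only after multiplication by this
   value, which is nonzero as [m >= 1]. *)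
have k0n0 : - (m%:R / mu.+1%:R) != 0 :> rat.
  by rewrite oppr_eq0 mulf_neq0 ?invr_eq0 ?pnatr_eq0 -?lt0n.
apply: (scalerI k0n0); case: jack => _ _ /(_ i) eig.
rewrite (singular_jucys_murphy zp sing (value_at_spectral _ _ _) eig) scalerA.
rewrite addrK rankc_decreasing ?mnmE; last first.
  move=> j j' jj'; rewrite !mnmE !(Lambda_row m rho_mu N_eq).
  have := row_of_decreasing (Tau mu s l rho) jj'.
  by repeat (case: ifP => ?); nia.
by rewrite (Lambda_eigenvalue rho_mu N_eq).
Qed.
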